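(* Suppose $\mathbf{X}^*$ is an optimal solution to the convex problem $\min_{\mathbf{X}\in\mathcal{F}_{n,k}} f(\mathbf{X})$ satisfying, for some $\delta>0$, the eigen-gap assumption $\lambda_{n-k}(\nabla f(\mathbf{X}^* ))-\lambda_{n-k+1}(\nabla f(\mathbf{X}^* ))\ge\delta$. Let $G\ge\sup_{\mathbf{X}\in\mathcal{F}_{n,k}}\|\nabla f(\mathbf{X})\|$ and let $\eta=\frac{1}{5\max\{\beta,G\}}$. Let $\{\mathbf{Q}_t\}_{t\ge1}\subset\mathbb{R}^{n\times k}$ be a sequence such that $\mathbf{Q}_1^\top\mathbf{Q}_1=\mathbf{I}$ and, for all $t\ge1$, $(\mathbf{Q}_{t+1},\mathbf{R}_{t+1})$ is a QR factorization of $\mathbf{Z}_{t+1}:=\mathbf{Q}_t-\eta\nabla f(\mathbf{Q}_t\mathbf{Q}_t^\top)\mathbf{Q}_t$. If $$\|\mathbf{Q}_1\mathbf{Q}_1^\top-\mathbf{X}^*\|_F\le\min\Big\{1,\sqrt{\tfrac{\delta}{2}}\Big\}\,\frac{\eta\delta}{2(1+\eta\beta)},$$ then for all $t\ge1$, $$f(\mathbf{Q}_t\mathbf{Q}_t^\top)-f(\mathbf{X}^* )\le\big(f(\mathbf{Q}_1\mathbf{Q}_1^\top)-f(\mathbf{X}^* )\big)\exp\Big(-\frac{\delta(t-1)}{40\max\{\beta,G\}}\Big).$$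
   Context: Let $1\le k<n$ be integers. $\mathbb{S}^n$ is the space of real symmetric $n\times n$ matrices with inner product $\langle \mathbf{A},\mathbf{B}\rangle=\mathrm{Tr}(\mathbf{A}\mathbf{B})$; $\|\cdot\|_F$ is the Frobenius norm and $\|\cdot\|$ is the spectral norm for matrices; $\lambda_i(\mathbf{A})$ is the $i$-th largest eigenvalue of $\mathbf{A}\in\mathbb{S}^n$. $\mathcal{P}_{n,k}=\{\mathbf{Q}\mathbf{Q}^\top : \mathbf{Q}\in\mathbb{R}^{n\times k},\ \mathbf{Q}^\top\mathbf{Q}=\mathbf{I}\}$, and the Fantope is $\mathcal{F}_{n,k}=\mathrm{conv}(\mathcal{P}_{n,k})=\{\mathbf{X}\in\mathbb{S}^n : \mathbf{I}\succeq\mathbf{X}\succeq0,\ \mathrm{Tr}(\mathbf{X})=k\}$. $f:\mathbb{S}^n\to\mathbb{R}$ is convex, differentiable and $\beta$-smooth, $\beta>0$: $\|\nabla f(\mathbf{X})-\nabla f(\mathbf{Y})\|_F\le\beta\|\mathbf{X}-\mathbf{Y}\|_F$ for all $\mathbf{X},\mathbf{Y}$; the gradient is a symmetric matrix. A QR factorization $(\mathbf{Q},\mathbf{R})$ of $\mathbf{Z}\in\mathbb{R}^{n\times k}$ means $\mathbf{Z}=\mathbf{Q}\mathbf{R}$ with $\mathbf{Q}\in\mathbb{R}^{n\times k}$, $\mathbf{Q}^\top\mathbf{Q}=\mathbf{I}$, and $\mathbf{R}\in\mathbb{R}^{k\times k}$ upper triangular. *)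

(* Defs.v *)
From HB Require Import structures.
From mathcomp Require Import all_boot all_order all_algebra.
From mathcomp Require Import all_classical all_reals all_analysis.
From mathcomp Require Import ring lra.
From mathcomp Require spectral complex.

Set Implicit Arguments.
Unset Strict Implicit.
Unset Printing Implicit Defensive.

Import Order.TTheory GRing.Theory Num.Theory.
Import numFieldNormedType.Exports.

Local Open Scope classical_set_scope.
Local Open Scope ring_scope.

Section MatrixNorms.
Context {R : realType}.

Definition frobenius m n (A : 'M[R]_(m, n)) : R :=
  Num.sqrt (\sum_i \sum_j A i j ^+ 2).

(* The norm induced by the Euclidean norm; on a column vector [frobenius] is
   the Euclidean norm. *)
Definition spectral_norm m n (A : 'M[R]_(m, n)) : R :=
  sup [set frobenius (A *m x) | x in [set x : 'cV[R]_n | frobenius x <= 1]].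

End MatrixNorms.

Definition symmetric_mx (R : realType) (n : nat) : {pred 'M[R]_n} :=
  [pred A | A^T == A].

Record symmx (R : realType) (n : nat) := SymMx {
  symmx_val :> 'M[R]_n;
  symmx_valP : symmx_val \in @symmetric_mx R n }.

Section SymMx.
Context {R : realType} {n : nat}.

HB.instance Definition _ := [isSub for @symmx_val R n].
HB.instance Definition _ := [Choice of symmx R n by <:].

Fact symmx_submod_closed : submod_closed (@symmetric_mx R n).
Proof.
split=> [|a A B]; first by rewrite inE trmx0.
rewrite !inE => /eqP hA /eqP hB.
by rewrite linearD linearZ /= hA hB.
Qed.

HB.instance Definition _ := GRing.isSubmodClosed.Build R 'M[R]_n
  (@symmetric_mx R n) symmx_submod_closed.
HB.instance Definition _ :=
  [SubChoice_isSubZmodule of symmx R n by <:].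
HB.instance Definition _ :=
  [SubZmodule_isSubLmodule of symmx R n by <:].

Definition symdot (A B : symmx R n) : R := \tr (A *m B).

Lemma symdot_sum (A B : symmx R n) :
  symdot A B = \sum_i \sum_j A i j * B i j.
Proof.
rewrite /symdot /mxtrace; apply: eq_bigr => i _; rewrite mxE.
apply: eq_bigr => j _; congr (_ * _).
by rewrite -{1}(eqP (symmx_valP B)) mxE.
Qed.

Lemma frobenius_symdot (A : symmx R n) : frobenius A = Num.sqrt (symdot A A).
Proof.
by rewrite symdot_sum; congr Num.sqrt; do 2!apply: eq_bigr => ? _; rewrite expr2.
Qed.

Lemma symdotC (A B : symmx R n) : symdot A B = symdot B A.
Proof. exact: mxtrace_mulC. Qed.

Lemma symdot_comb (x y : R) (A B : symmx R n) :
  symdot (x *: A + y *: B) (x *: A + y *: B) =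
  x ^+ 2 * symdot A A + 2 * x * y * symdot A B + y ^+ 2 * symdot B B.
Proof.
rewrite /symdot /= !(mulmxDl, mulmxDr) -!(scalemxAl, scalemxAr).
rewrite !(mxtraceD, mxtraceZ) (mxtrace_mulC B A); ring.
Qed.

Lemma symdot_ge0 (A : symmx R n) : 0 <= symdot A A.
Proof.
by rewrite symdot_sum; do 2!apply: sumr_ge0 => ? _; rewrite -expr2 sqr_ge0.
Qed.

Lemma symdot_eq0 (A : symmx R n) : symdot A A = 0 -> A = 0.
Proof.
rewrite symdot_sum => h; apply/val_inj/matrixP => i j; rewrite mxE.
have h1 : forall i, true -> 0 <= \sum_j A i j * A i j.
  by move=> ? _; apply: sumr_ge0 => ? _; rewrite -expr2 sqr_ge0.
have /eqP := h; rewrite psumr_eq0// => /allP/(_ i (mem_index_enum _)) /=.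
rewrite psumr_eq0; last by move=> ? _; rewrite -expr2 sqr_ge0.
move=> /allP/(_ j (mem_index_enum _)) /=.
by rewrite mulf_eq0 orbb => /eqP.
Qed.

Lemma symdot_CS (A B : symmx R n) :
  symdot A B ^+ 2 <= symdot A A * symdot B B.
Proof.
have [h|h] := eqVneq (symdot B B) 0.
  have -> : symdot A B = 0.
    by rewrite (symdot_eq0 h) symdotC /symdot mul0mx mxtrace0.
  by rewrite expr0n mulr_ge0// symdot_ge0.
have c0 : 0 < symdot B B by rewrite lt_def h symdot_ge0.
have := symdot_ge0 (symdot B B *: A + (- symdot A B) *: B).
rewrite symdot_comb => h1; rewrite -(ler_pM2l c0) -subr_ge0.
by apply: le_trans h1 _; rewrite le_eqVlt; apply/orP; left; apply/eqP; ring.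
Qed.

Fact symmx_norm_triangle (A B : symmx R n) :
  frobenius (A + B : symmx R n) <= frobenius A + frobenius B.
Proof.
rewrite !frobenius_symdot.
have := symdot_ge0 (1 *: A + 1 *: B).
have -> : symdot (A + B) (A + B) = symdot (1 *: A + 1 *: B) (1 *: A + 1 *: B).
  by rewrite !scale1r.
rewrite symdot_comb expr1n !mul1r !mulr1.
set a := symdot A A; set b := symdot A B; set c := symdot B B.
have a0 : 0 <= a by exact: symdot_ge0.
have c0 : 0 <= c by exact: symdot_ge0.
move=> h; rewrite -(@ler_pXn2r _ 2)// ?nnegrE ?addr_ge0 ?sqrtr_ge0//.
rewrite sqr_sqrtr//.
rewrite sqrrD !sqr_sqrtr// -mulr_natl mulrC.
suff : b <= Num.sqrt a * Num.sqrt c by lra.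
rewrite -sqrtrM//; apply: le_trans (ler_norm _) _.
by rewrite -sqrtr_sqr ler_wsqrtr// symdot_CS.
Qed.

Fact symmx_normZ (a : R) (A : symmx R n) :
  frobenius (a *: A : symmx R n) = `|a| * frobenius A.
Proof.
rewrite !frobenius_symdot /symdot /= -scalemxAl -scalemxAr !mxtraceZ mulrA.
by rewrite -expr2 sqrtrM ?sqr_ge0// sqrtr_sqr.
Qed.

Fact symmx_norm_eq0 (A : symmx R n) : frobenius A = 0 -> A = 0.
Proof.
rewrite frobenius_symdot => /eqP; rewrite sqrtr_eq0 => h.
by apply: symdot_eq0; apply/eqP; rewrite eq_le h symdot_ge0.
Qed.

(* The space of symmetric matrices is normed by the Frobenius norm, so [`|A|]
   below is [frobenius A], and [differentiable], ['d f X] refer to this norm. *)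
HB.instance Definition _ := Lmodule_isNormed.Build R (symmx R n)
  symmx_norm_triangle symmx_normZ symmx_norm_eq0.

Lemma symmx_normE (A : symmx R n) : `|A| = frobenius A.
Proof. by []. Qed.

End SymMx.

Section Eigenvalues.
Import complex.
Context {R : realType}.

(* The eigenvalues of [A], repeated according to multiplicity, in nonincreasing
   order; [eigvalsP] shows that the list exists for a symmetric matrix. *)
Definition eigvals n (A : 'M[R]_n) : seq R :=
  xget [::] [set s | sorted >=%R s /\ char_poly A = \prod_(a <- s) ('X - a%:P)].

(* The [i]-th largest eigenvalue, for 1 <= i <= n. *)
Definition eigval n (i : nat) (A : 'M[R]_n) : R := nth 0 (eigvals A) i.-1.

Lemma eigvals_exist n (A : symmx R n) :
  exists s, sorted >=%R s /\ char_poly A = \prod_(a <- s) ('X - a%:P).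
Proof.
pose C : numClosedFieldType := complex.complex R.
pose f : {rmorphism R -> C} := complex.real_complex R.
pose B : 'M[C]_n := map_mx f A.
have freal x : f x \is Num.real by apply/complex.complex_realP; exists x.
have Breal : B \is a mxOver Num.real.
  by apply/mxOverP => i j; rewrite mxE freal.
have Bsym : B \is symmetricmx.
  apply/is_hermitianmxP; rewrite expr0 scale1r map_mx_id//.
  by apply/matrixP => i j; rewrite !mxE -{1}(eqP (symmx_valP A)) mxE.
have Bherm := spectral.realsym_hermsym Bsym Breal.
have /spectral.orthomx_spectralP := spectral.hermitian_normalmx Bherm.
have /mxOverP := spectral.hermitian_spectral_diag_real Bherm.
set d := spectral.spectral_diag B; set P := spectral.spectralmx B => dreal BE.
have Punit : P \in unitmx by exact: spectral.spectral_unit.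
have BP : char_poly B = \prod_(i < n) ('X - (d 0 i)%:P).
  have -> : char_poly B = char_poly (diag_mx d).
    rewrite /char_poly /char_poly_mx BE !map_mxM.
    set Pi := map_mx polyC (invmx P); set Pp := map_mx polyC P.
    have PiP : Pi *m Pp = 1%:M by rewrite -map_mxM mulVmx// map_mx1.
    have -> : 'X%:M - Pi *m map_mx polyC (diag_mx d) *m Pp =
              Pi *m ('X%:M - map_mx polyC (diag_mx d)) *m Pp.
      rewrite mulmxBr mulmxBl; congr (_ - _).
      by rewrite scalar_mxC -mulmxA PiP mulmx1.
    by rewrite !det_mulmx mulrAC -det_mulmx PiP det1 mul1r.
  rewrite char_poly_trig; last by exact: diag_mx_is_trig.
  by apply: eq_bigr => i _; rewrite mxE eqxx mulr1n.
have dE i : {x : R | d 0 i = f x}.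
  by apply: cid; have /complex.complex_realP[x ->] := dreal 0 i; exists x.
pose s := [seq sval (dE i) | i <- enum 'I_n].
exists (sort >=%R s); split.
  by apply: sort_sorted => x y; exact: le_total.
rewrite (perm_big s) /=; last by rewrite perm_sort.
apply: (map_poly_inj f).
rewrite (map_char_poly f) BP rmorph_prod big_map big_enum /=.
apply: eq_bigr => i _; rewrite rmorphB/= map_polyX map_polyC/=.
by rewrite -(svalP (dE i)).
Qed.

Lemma eigvalsP n (A : symmx R n) :
  sorted >=%R (eigvals A) /\
  char_poly A = \prod_(a <- eigvals A) ('X - a%:P).
Proof.
by rewrite /eigvals; case: xgetP => [s _ //|/forallNP[]];
exact: eigvals_exist.
Qed.

End Eigenvalues.

Section Fantope.
Context {R : realType}.

Lemma gram_subproof n k (Q : 'M[R]_(n, k)) :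
  Q *m Q^T \in @symmetric_mx R n.
Proof. by rewrite inE trmx_mul trmxK. Qed.

Definition gram n k (Q : 'M[R]_(n, k)) : symmx R n := SymMx (gram_subproof Q).

Definition projections n k : set (symmx R n) :=
  [set gram Q | Q in [set Q : 'M[R]_(n, k) | Q^T *m Q = 1%:M]].

(* The convex hull of [projections n k]. *)
Definition fantope n k : set (symmx R n) :=
  smallest (@convex_set R (symmx R n)) (@projections n k).

Definition is_qr n k (Z Q : 'M[R]_(n, k)) (U : 'M[R]_k) : Prop :=
  [/\ Z = Q *m U, Q^T *m Q = 1%:M & forall i j : 'I_k, (j < i)%N -> U i j = 0].

End Fantope.

Arguments projections {R} n k.
Arguments fantope {R} n k.

(* Main.v *)
Require Import Defs.
From mathcomp Require Import all_boot all_order all_algebra.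
From mathcomp Require Import all_classical all_reals all_analysis.
From mathcomp Require Import ring lra zify.

Set Implicit Arguments.
Unset Strict Implicit.
Unset Printing Implicit Defensive.

Import Order.TTheory GRing.Theory Num.Theory.
Import numFieldNormedType.Exports.

Local Open Scope classical_set_scope.
Local Open Scope ring_scope.

(** Write [P] for the projection [Q_t Q_t^T], [P'] for the next one, [g] for the
    gradient at [P], [h] for the optimality gap at [P] and [d] for the Frobenius
    distance from [P] to [X*], which the eigengap forces to be the projection
    onto the [k] lowest eigenvectors of the gradient at [X*].

    With [A = 1 - eta g], invariance of the range gives [P' A P = A P], hence
    [tr (A (P' - P)) = tr ((P' - P) A (P' - P))]: the first-order decrease is at
    least a multiple of [|P' - P|^2], which in turn bounds the off-diagonal
    block [(1 - P) g P] of the gradient.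

    Conversely [h <= <g, P - X*>] by convexity. The off-diagonal part of this
    product is controlled by [(1 - P) g P] and [d]. Its block-diagonal part is
    nonpositive up to the change of the gradient from [X*] to [P]; that error is
    absorbed because co-coercivity bounds the squared change of the gradient by
    [h], and because [d^2] stays below [3 delta / (100 max (beta, G))]. The
    latter propagates since [h] decreases and [delta/2 d^2 <= h] (quadratic
    growth), so no monotonicity of [d] is required. *)

(** * Trace inner product and squared Frobenius norm *)

Section SquaredNorm.
Context {R : realFieldType}.

Definition sqnorm m n (A : 'M[R]_(m, n)) : R := \tr (A *m A^T).

Lemma mxtraceB n (A B : 'M[R]_n) : \tr (A - B) = \tr A - \tr B.
Proof. exact: raddfB. Qed.

Lemma mxtraceN n (A : 'M[R]_n) : \tr (- A) = - \tr A.
Proof. exact: raddfN. Qed.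

Lemma mxtrace_mul_trE m n (A B : 'M[R]_(m, n)) :
  \tr (A *m B^T) = \sum_i \sum_j A i j * B i j.
Proof.
rewrite /mxtrace; apply: eq_bigr => i _; rewrite mxE.
by apply: eq_bigr => j _; rewrite mxE.
Qed.

Lemma mxtrace_trC m n (A B : 'M[R]_(m, n)) :
  \tr (A *m B^T) = \tr (B *m A^T).
Proof. by rewrite -mxtrace_tr trmx_mul trmxK. Qed.

Lemma sqnormE m n (A : 'M[R]_(m, n)) : sqnorm A = \sum_i \sum_j A i j ^+ 2.
Proof.
by rewrite /sqnorm mxtrace_mul_trE; do 2!apply: eq_bigr => ? _; rewrite expr2.
Qed.

Lemma sqnorm_ge0 m n (A : 'M[R]_(m, n)) : 0 <= sqnorm A.
Proof. by rewrite sqnormE; do 2!apply: sumr_ge0 => ? _; rewrite sqr_ge0. Qed.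

Lemma sqnorm_eq0 m n (A : 'M[R]_(m, n)) : sqnorm A = 0 -> A = 0.
Proof.
rewrite sqnormE => /eqP; rewrite psumr_eq0 => [/allP h|i _]; last first.
  by apply: sumr_ge0 => ? _; rewrite sqr_ge0.
apply/matrixP => i j; rewrite mxE.
have := h i (mem_index_enum _).
rewrite /= psumr_eq0 => [/allP h'|? _]; last by rewrite sqr_ge0.
by have := h' j (mem_index_enum _); rewrite /= sqrf_eq0 => /eqP.
Qed.

Lemma sqnorm_tr m n (A : 'M[R]_(m, n)) : sqnorm A^T = sqnorm A.
Proof. by rewrite /sqnorm trmxK mxtrace_mulC. Qed.

Lemma sqnormN m n (A : 'M[R]_(m, n)) : sqnorm (- A) = sqnorm A.
Proof. by rewrite /sqnorm linearN mulmxN mulNmx opprK. Qed.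

Lemma sqnormZ m n a (A : 'M[R]_(m, n)) : sqnorm (a *: A) = a ^+ 2 * sqnorm A.
Proof.
by rewrite /sqnorm linearZ -scalemxAl -scalemxAr scalerA mxtraceZ -expr2.
Qed.

Lemma sqnormD m n (A B : 'M[R]_(m, n)) :
  sqnorm (A + B) = sqnorm A + 2 * \tr (A *m B^T) + sqnorm B.
Proof.
rewrite /sqnorm linearD /= mulmxDl !mulmxDr !mxtraceD (mxtrace_trC B A); ring.
Qed.

Lemma mxtrace_CauchySchwarz m n (A B : 'M[R]_(m, n)) :
  \tr (A *m B^T) ^+ 2 <= sqnorm A * sqnorm B.
Proof.
have [h|h] := eqVneq (sqnorm B) 0.
  by rewrite (sqnorm_eq0 h) trmx0 mulmx0 mxtrace0 expr0n mulr_ge0// sqnorm_ge0.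
have c0 : 0 < sqnorm B by rewrite lt_def h sqnorm_ge0.
have := sqnorm_ge0 (sqnorm B *: A + (- \tr (A *m B^T)) *: B).
rewrite sqnormD !sqnormZ linearZ /= -scalemxAl -scalemxAr !mxtraceZ => h1.
rewrite -(ler_pM2l c0) -subr_ge0.
by apply: le_trans h1 _; rewrite le_eqVlt; apply/orP; left; apply/eqP; ring.
Qed.

Lemma sqnorm_row m n (A : 'M[R]_(m, n)) : sqnorm A = \sum_i sqnorm (row i A).
Proof.
rewrite sqnormE; apply: eq_bigr => i _; rewrite sqnormE big_ord1.
by apply: eq_bigr => j _; rewrite mxE.
Qed.

(** Cauchy-Schwarz for each entry of the product, a row of [A] against a column of [B], summed over
    all entries. *)
Lemma sqnorm_mulmx m n p (A : 'M[R]_(m, n)) (B : 'M[R]_(n, p)) :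
  sqnorm (A *m B) <= sqnorm A * sqnorm B.
Proof.
rewrite [leLHS]sqnormE (sqnorm_row A) mulr_suml; apply: ler_sum => i _.
rewrite -(sqnorm_tr B) (sqnorm_row B^T) mulr_sumr; apply: ler_sum => j _.
have := mxtrace_CauchySchwarz (row i A) (row j B^T).
rewrite mxtrace_mul_trE big_ord1 mxE.
by under eq_bigr do rewrite !mxE.
Qed.

End SquaredNorm.

(** * Pairs of orthogonal projections and their block decomposition *)

Section OrthogonalProjections.
Context {R : realFieldType} {n : nat}.
Implicit Types P X M : 'M[R]_n.

Definition orthoproj P : Prop := P^T = P /\ P *m P = P.

Lemma orthoproj_compl P : orthoproj P -> orthoproj (1%:M - P).
Proof.
move=> [Pt PP]; split; first by rewrite linearB /= trmx1 Pt.
by rewrite mulmxBl !mulmxBr !mul1mx mulmx1 PP subrr subr0.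
Qed.

Lemma sqnorm_mul_orthoproj m (A : 'M[R]_(m, n)) P : orthoproj P ->
  sqnorm (A *m P) = \tr (A *m P *m A^T).
Proof.
by move=> [Pt PP]; rewrite /sqnorm trmx_mul Pt mulmxA -(mulmxA A) PP.
Qed.

(** Pythagoras: the squared norms of [A *m P] and [A *m (1%:M - P)] add up to that of [A]. *)
Lemma sqnorm_mul_orthoproj_le m (A : 'M[R]_(m, n)) P : orthoproj P ->
  sqnorm (A *m P) <= sqnorm A.
Proof.
move=> oP; have := sqnorm_ge0 (A *m (1%:M - P)).
rewrite (sqnorm_mul_orthoproj _ oP).
rewrite (sqnorm_mul_orthoproj _ (orthoproj_compl oP)).
by rewrite mulmxBr mulmx1 mulmxBl mxtraceB subr_ge0.
Qed.

Lemma sqnorm_mul_orthoproj2 P X : orthoproj P -> orthoproj X ->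
  sqnorm (P *m X) = \tr (P *m X).
Proof.
move=> [Pt PP] oX; rewrite sqnorm_mul_orthoproj// Pt -mxtrace_mulC mulmxA.
by rewrite PP.
Qed.

(** For orthogonal projections the common value is half of [sqnorm (P - X)], so each overlap defect
    measures the distance. *)
Lemma mxtrace_orthoproj_compl P X : \tr P = \tr X ->
  \tr (P *m (1%:M - X)) = \tr P - \tr (P *m X) /\
  \tr ((1%:M - P) *m X) = \tr P - \tr (P *m X).
Proof.
by move=> t; rewrite mulmxBr mulmx1 mulmxBl mul1mx !mxtraceB t.
Qed.

Lemma sqnorm_orthoprojB P X : orthoproj P -> orthoproj X -> \tr P = \tr X ->
  sqnorm (P - X) = 2 * (\tr P - \tr (P *m X)).
Proof.
move=> [Pt PP] [Xt XX] t; rewrite /sqnorm linearB /= Pt Xt.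
rewrite mulmxBl !mulmxBr PP XX !mxtraceB (mxtrace_mulC X P) -t; ring.
Qed.

(* The part of [P - X] that is block diagonal with respect to [P]. *)
Definition diag_part P X : 'M[R]_n :=
  P *m (1%:M - X) *m P - (1%:M - P) *m X *m (1%:M - P).

Lemma tr_diag_part P X :
  orthoproj P -> orthoproj X -> (diag_part P X)^T = diag_part P X.
Proof.
move=> oP oX; have [Pt _] := oP; have [Xt _] := oX.
have [Qt _] := orthoproj_compl oP; have [Yt _] := orthoproj_compl oX.
by rewrite /diag_part linearB /= !trmx_mul Pt Xt Qt Yt !mulmxA.
Qed.

Lemma orthoprojB_split P X : orthoproj P ->
  P - X = diag_part P X
    - (P *m X *m (1%:M - P) + (1%:M - P) *m X *m P).
Proof.
move=> [_ PP]; rewrite /diag_part !(mulmxBl, mulmxBr) !(mul1mx, mulmx1) PP.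
by apply/matrixP => i j; rewrite !mxE; ring.
Qed.

Lemma sqnorm_sandwich P X : orthoproj P -> orthoproj X ->
  sqnorm (P *m X *m P) <= sqnorm (P *m X) ^+ 2.
Proof.
move=> [Pt PP] [Xt XX].
have -> : P *m X *m P = (P *m X) *m (P *m X)^T.
  by rewrite trmx_mul Pt Xt !mulmxA -(mulmxA P X X) XX.
by rewrite (le_trans (sqnorm_mulmx _ _))// sqnorm_tr expr2.
Qed.

(** The diagonal part is of second order in [P - X]: each block is a Gram matrix of
    [P *m (1%:M - X)] or [(1%:M - P) *m X], whose squared norm is [s], half of [sqnorm (P - X)]. The
    parallelogram bound then gives [4 * s ^+ 2]. *)
Lemma sqnorm_diag_part P X : orthoproj P -> orthoproj X -> \tr P = \tr X ->
  sqnorm (diag_part P X) <= sqnorm (P - X) ^+ 2.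
Proof.
move=> oP oX t; have oP' := orthoproj_compl oP; have oX' := orthoproj_compl oX.
have [t1 t2] := mxtrace_orthoproj_compl t.
have h1 := sqnorm_sandwich oP oX'; have h2 := sqnorm_sandwich oP' oX.
rewrite (sqnorm_mul_orthoproj2 oP oX') t1 in h1.
rewrite (sqnorm_mul_orthoproj2 oP' oX) t2 in h2.
rewrite sqnorm_orthoprojB// /diag_part.
set A := _ *m P in h1 *; set B := _ *m (1%:M - P) in h2 *.
set s := _ - _ in h1 h2 *.
have := sqnorm_ge0 (A + B); rewrite sqnormD => h.
rewrite sqnormD sqnormN linearN mulmxN /= mxtraceN; lra.
Qed.

End OrthogonalProjections.

(** * Spectral theorem for real symmetric matrices *)

Section RealSpectralTheorem.
Context {R : rcfType}.

Lemma mxE_trace11 (A : 'M[R]_1) : A = (\tr A)%:M.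
Proof. by rewrite trace_mx11 -mx11_scalar. Qed.

Lemma char_poly_similar n (H A : 'M[R]_n) :
  H *m H^T = 1%:M -> char_poly (H *m A *m H^T) = char_poly A.
Proof.
move=> HHt; rewrite /char_poly /char_poly_mx !map_mxM /=.
set h := map_mx polyC H; set ht := map_mx polyC H^T.
have hht : h *m ht = 1%:M by rewrite -map_mxM HHt map_mx1.
have -> : 'X%:M - h *m map_mx polyC A *m ht =
    h *m ('X%:M - map_mx polyC A) *m ht.
  by rewrite mulmxBr mulmxBl scalar_mxC -(mulmxA _ h ht) hht mulmx1.
by rewrite !det_mulmx mulrAC -det_mulmx hht det1 mul1r.
Qed.

Lemma char_poly_block_diag m n (A : 'M[R]_m) (B : 'M[R]_n) :
  char_poly (block_mx A 0 0 B) = char_poly A * char_poly B.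
Proof.
rewrite /char_poly /char_poly_mx map_block_mx !map_mx0 scalar_mx_block.
by rewrite opp_block_mx !oppr0 add_block_mx !addr0 det_ublock.
Qed.

(* The Householder reflection exchanging [u] and the first basis vector. *)
Lemma orthogonal_completion n (u : 'rV[R]_(1 + n)) :
  sqnorm u = 1 -> exists2 H : 'M[R]_(1 + n), H *m H^T = 1%:M & row 0 H = u.
Proof.
move=> u1; pose e : 'rV[R]_(1 + n) := delta_mx 0 0.
have ee : e *m e^T = 1%:M.
  by rewrite trmx_delta mul_delta_mx; apply/matrixP => i j; rewrite !ord1 !mxE.
have e1 : sqnorm e = 1 by rewrite /sqnorm ee mxtrace1.
pose w := e - u; pose c := sqnorm w.
have [c0|c0] := eqVneq c 0.
  exists 1%:M; first by rewrite trmx1 mulmx1.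
  by rewrite rowE mulmx1; apply/subr0_eq/(sqnorm_eq0 c0).
(* As [e] and [u] are unit vectors, subtracting [(2 / c) *: w] scaled by this inner product removes
   exactly [w] from [e], leaving [u]. *)
have ew : 2 * \tr (e *m w^T) = c.
  rewrite /c /w sqnormD sqnormN linearB /= mulmxBr linearN mulmxN /=.
  rewrite mxtraceB mxtraceN.
  by rewrite -[\tr (e *m e^T)]/(sqnorm e) e1 u1; ring.
have ww : w *m w^T = c%:M by rewrite [LHS]mxE_trace11.
exists (1%:M - (2 / c) *: (w^T *m w)).
  pose W := w^T *m w.
  have Wt : W^T = W by rewrite trmx_mul trmxK.
  have WW : W *m W = c *: W.
    by rewrite mulmxA -(mulmxA w^T w) ww scalar_mxC mul_scalar_mx -scalemxAl.
  have -> : (1%:M - (2 / c) *: (w^T *m w))^T = 1%:M - (2 / c) *: W.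
    by rewrite linearB /= trmx1 [X in _ - X]linearZ /= Wt.
  rewrite -/W.
  rewrite mulmxBl !mulmxBr !mul1mx mulmx1 -scalemxAl -scalemxAr WW !scalerA.
  apply/matrixP => i j; rewrite !mxE; field.
  exact: c0.
rewrite rowE -/e mulmxBr mulmx1 -scalemxAr mulmxA (mxE_trace11 (e *m w^T)).
rewrite mul_scalar_mx scalerA (_ : _ * _ = 1) ?scale1r ?subKr//.
by rewrite mulrAC ew divff.
Qed.

Lemma symmetric_first_row_block n (B : 'M[R]_(1 + n)) a :
  B^T = B -> row 0 B = a *: delta_mx 0 0 ->
  B = block_mx a%:M 0 0 (drsubmx B).
Proof.
move=> Bt /rowP B0.
have l0 (i : 'I_1) : @lshift 1 n i = 0 by apply/val_inj; rewrite ord1.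
have {}B0 j : B 0 j = a *+ (j == 0).
  by have := B0 j; rewrite !mxE => ->; rewrite eqxx /= mulr_natr.
rewrite -[LHS]submxK; congr block_mx; apply/matrixP => i j; rewrite !mxE.
- by rewrite !l0 B0 !ord1.
- by rewrite l0 B0.
- by rewrite l0 -Bt mxE B0.
Qed.

(** Deflation: a unit eigenvector for the head of [s] becomes the first row of an orthogonal matrix,
    conjugation splits off a 1 by 1 block, and the remaining block has the tail of [s] as spectrum.
    Fixing [s] in advance ties row [i] of [V] to the eigenvalue listed at [i]. *)
Lemma real_spectral n (A : 'M[R]_n) (s : seq R) :
  A^T = A -> char_poly A = \prod_(a <- s) ('X - a%:P) ->
  exists2 V : 'M[R]_n, V *m V^T = 1%:M &
    V *m A = diag_mx (\row_i s`_i) *m V.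
Proof.
elim: n => [|n IHn] in A s *.
  by move=> _ _; exists 1%:M; apply/matrixP => -[].
rewrite -[n.+1]/(1 + n)%N in A * => At As.
have : size s = (1 + n)%N.
  by apply: succn_inj; rewrite -(size_char_poly A) As size_prod_XsubC.
case: s As => // a s As _.
have : eigenvalue A a.
  by rewrite eigenvalue_root_char As big_cons rootM root_XsubC eqxx.
case/eigenvalueP => v vA v0.
have nv : 0 < sqnorm v.
  rewrite lt_def sqnorm_ge0 andbT.
  by apply: contraNneq v0 => /sqnorm_eq0 ->.
pose u := (Num.sqrt (sqnorm v))^-1 *: v.
have u1 : sqnorm u = 1.
  by rewrite sqnormZ exprVn sqr_sqrtr ?sqnorm_ge0// mulVf// gt_eqF.
have uA : u *m A = a *: u by rewrite -scalemxAl vA !scalerA mulrC.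
have [H HHt H0] := orthogonal_completion u1.
have HtH := mulmx1C HHt.
pose B := H *m A *m H^T.
have Bt : B^T = B by rewrite !trmx_mul trmxK At mulmxA.
have B0 : row 0 B = a *: delta_mx 0 0.
  rewrite /B -mulmxA row_mul H0 mulmxA uA -scalemxAl -H0 -row_mul HHt.
  by rewrite rowE mulmx1.
pose C := drsubmx B.
have BE : B = block_mx a%:M 0 0 C by exact: symmetric_first_row_block.
have Ct : C^T = C by rewrite /C trmx_drsub Bt.
have Cs : char_poly C = \prod_(a <- s) ('X - a%:P).
  have := char_poly_similar A HHt.
  rewrite -/B BE char_poly_block_diag As big_cons.
  rewrite {1}/char_poly /char_poly_mx map_scalar_mx /= -raddfB /= det_scalar1.
  by apply: mulfI; rewrite polyXsubC_eq0.
have [V' VV' V'C] := IHn C s Ct Cs.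
exists (block_mx 1%:M 0 0 V' *m H).
  rewrite trmx_mul mulmxA -(mulmxA _ H) HHt mulmx1 tr_block_mx !trmx0 trmx1.
  by rewrite mulmx_block !mulmx0 !mul0mx !addr0 add0r mulmx1 VV' -scalar_mx_block.
have HA : H *m A = B *m H by rewrite /B -mulmxA HtH mulmx1.
rewrite -mulmxA HA mulmxA (mulmxA (diag_mx _)); congr (_ *m H).
have -> : (\row_i (a :: s)`_i : 'rV_(1 + n)) = row_mx a%:M (\row_i s`_i).
  apply/rowP => i; rewrite !mxE; case: splitP => j ->; rewrite !mxE ?ord1//.
rewrite diag_mx_row BE !mulmx_block !mulmx0 !mul0mx !addr0 !add0r V'C.
rewrite mul1mx mulmx1; congr block_mx.
by apply/matrixP => i j; rewrite !mxE !ord1.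
Qed.

End RealSpectralTheorem.

(** * Quadratic forms and traces in an orthonormal basis *)

Section QuadraticForm.
Context {R : realFieldType}.

(** Allowing several rows lets one form serve both single eigenvectors and the displacement
    [P' - P]. *)
Definition quad m n (u : 'M[R]_(m, n)) (M : 'M[R]_n) : R := \tr (u *m M *m u^T).

Lemma quadD m n (u : 'M[R]_(m, n)) M N : quad u (M + N) = quad u M + quad u N.
Proof. by rewrite /quad mulmxDr mulmxDl mxtraceD. Qed.

Lemma quadN m n (u : 'M[R]_(m, n)) M : quad u (- M) = - quad u M.
Proof. by rewrite /quad mulmxN mulNmx mxtraceN. Qed.

Lemma quadZ m n (u : 'M[R]_(m, n)) a M : quad u (a *: M) = a * quad u M.
Proof. by rewrite /quad -scalemxAr -scalemxAl mxtraceZ. Qed.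

Lemma quad1 m n (u : 'M[R]_(m, n)) : quad u 1%:M = sqnorm u.
Proof. by rewrite /quad mulmx1. Qed.

Lemma quad_mulmx_l m n (u : 'M[R]_(m, n)) a M N :
  u *m M = a *: u -> quad u (M *m N) = a * quad u N.
Proof. by rewrite /quad mulmxA => ->; rewrite -!scalemxAl mxtraceZ. Qed.

Lemma quad_mulmx_r m n (u : 'M[R]_(m, n)) a M N :
  M^T = M -> u *m M = a *: u -> quad u (N *m M) = a * quad u N.
Proof.
move=> Mt uM; rewrite /quad -!mulmxA (_ : M *m u^T = a *: u^T).
  by rewrite -!scalemxAr mxtraceZ.
by apply: trmx_inj; rewrite trmx_mul trmxK Mt uM linearZ /= trmxK.
Qed.

Lemma quad_sandwich m n (u : 'M[R]_(m, n)) (M N : 'M[R]_n) :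
  M^T = M -> quad u (M *m N *m M) = quad (u *m M) N.
Proof. by move=> Mt; rewrite /quad trmx_mul Mt !mulmxA. Qed.

Lemma quad_orthoproj m n (u : 'M[R]_(m, n)) P :
  orthoproj P -> quad u P = sqnorm (u *m P).
Proof. by move=> /sqnorm_mul_orthoproj ->. Qed.

Context {n : nat} (V : 'M[R]_n) (VVt : V *m V^T = 1%:M).

Lemma sqnorm_orthogonal_row i : sqnorm (row i V) = 1.
Proof.
have -> : sqnorm (row i V) = (V *m V^T) i i.
  by rewrite sqnormE big_ord1 mxE; apply: eq_bigr => j _; rewrite !mxE expr2.
by rewrite VVt mxE eqxx.
Qed.

Lemma mxtrace_quad_row M : \tr M = \sum_i quad (row i V) M.
Proof.
rewrite -{1}[M]mulmx1 -(mulmx1C VVt) mulmxA mxtrace_mulC mulmxA mxtrace_mul_trE.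
apply: eq_bigr => i _; rewrite /quad -row_mul mxtrace_mul_trE big_ord1.
by apply: eq_bigr => j _; rewrite [in RHS]mxE [row i V _ _]mxE.
Qed.

Lemma sqnorm_mul_row (M : 'M[R]_n) : sqnorm M = \sum_i sqnorm (row i V *m M).
Proof.
rewrite -(sqnorm_tr M) /sqnorm trmxK mxtrace_mulC mxtrace_quad_row.
by apply: eq_bigr => i _; rewrite /quad trmx_mul !mulmxA.
Qed.

End QuadraticForm.

(** * Spectral projection onto the lowest eigenvalues *)

Section BottomEigenspace.
Context {R : realFieldType} {n : nat}.
Implicit Types A P X : 'M[R]_n.

Lemma mxtrace_sandwich P X : orthoproj P -> \tr (P *m X *m P) = \tr (P *m X).
Proof. by move=> [_ PP]; rewrite mxtrace_mulC mulmxA PP. Qed.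

Lemma mxtrace_diag_part P X :
  orthoproj P -> \tr P = \tr X -> \tr (diag_part P X) = 0.
Proof.
move=> oP t; have [t1 t2] := mxtrace_orthoproj_compl t.
rewrite /diag_part mxtraceB !mxtrace_sandwich ?t1 ?t2 ?subrr//.
exact: orthoproj_compl.
Qed.

(** This symmetry reduces vectors fixed by [X] to vectors in its kernel. *)
Lemma diag_part_compl P X :
  diag_part (1%:M - P) (1%:M - X) = - diag_part P X.
Proof. by rewrite /diag_part !subKr opprB. Qed.

Lemma diag_partE P X : orthoproj P ->
  diag_part P X = P + P *m X + X *m P - X - (P *m X *m P) *+ 2.
Proof.
move=> [_ PP]; rewrite /diag_part !(mulmxBl, mulmxBr) !(mul1mx, mulmx1) PP.
by apply/matrixP => i j; rewrite !mxE; ring.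
Qed.

Lemma quad_orthoprojB_ker m (u : 'M[R]_(m, n)) P X :
  orthoproj P -> orthoproj X -> u *m X = 0 ->
  quad u (P - X) = sqnorm (u *m (P - X)).
Proof.
move=> oP oX uX; rewrite quadD quadN !quad_orthoproj// uX.
by rewrite mulmxBr uX subr0 /sqnorm mul0mx mxtrace0 subr0.
Qed.

(** When [u *m X = 0], the left side equals [- sqnorm (u *m P)] plus twice
    [sqnorm (u *m P *m (1%:M - X))]. The latter is at most [sqnorm (u *m P)] times
    [sqnorm (P *m (1%:M - X))], which is half of [sqnorm (P - X)]. *)
Lemma quad_diag_part_ker m (u : 'M[R]_(m, n)) P X :
  orthoproj P -> orthoproj X -> \tr P = \tr X -> u *m X = 0 ->
  quad u (diag_part P X) <= - (1 - sqnorm (P - X)) * quad u (P - X).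
Proof.
move=> oP oX t uX; have [Pt PP] := oP; have [Xt _] := oX.
have oX' := orthoproj_compl oX.
have uX0 : u *m X = 0 *: u by rewrite scale0r.
have qX : quad u X = 0 by rewrite /quad uX mul0mx mxtrace0.
have qPX : quad u (P *m X) = 0 by rewrite (quad_mulmx_r _ Xt uX0) mul0r.
have qXP : quad u (X *m P) = 0 by rewrite (quad_mulmx_l _ uX0) mul0r.
have qP : quad u P = sqnorm (u *m P) by exact: quad_orthoproj.
have qPXP : quad u (P *m X *m P) = quad u P - sqnorm (u *m P *m (1%:M - X)).
  rewrite quad_sandwich// -quad_orthoproj// quadD quadN quad1 qP.
  by rewrite opprB addrC subrK.
have [t1 _] := mxtrace_orthoproj_compl t.
have : sqnorm (u *m P *m (1%:M - X)) <= quad u P * (sqnorm (P - X) / 2).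
  rewrite sqnorm_orthoprojB// mulrC [2 * _]mulrC mulfK ?pnatr_eq0//.
  rewrite -t1 -(sqnorm_mul_orthoproj2 oP oX') qP mulrC.
  by rewrite -{1}PP mulmxA -mulmxA sqnorm_mulmx.
rewrite diag_partE// (mulr2n (P *m X *m P)) opprD.
rewrite !(quadD, quadN) qPX qXP qX qPXP; lra.
Qed.

Lemma quad_diag_part_fix m (u : 'M[R]_(m, n)) P X :
  orthoproj P -> orthoproj X -> \tr P = \tr X -> u *m X = u ->
  - (1 - sqnorm (P - X)) * quad u (P - X) <= quad u (diag_part P X).
Proof.
move=> oP oX t uX.
have := @quad_diag_part_ker _ u _ _ (orthoproj_compl oP) (orthoproj_compl oX).
rewrite !mxtraceB t mulmxBr mulmx1 uX subrr diag_part_compl quadN.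
have -> : 1%:M - P - (1%:M - X) = - (P - X) :> 'M[R]_n.
  by apply/matrixP => i j; rewrite !mxE; ring.
rewrite quadN sqnormN => /(_ erefl erefl); lra.
Qed.

Lemma quad_orthoprojB_fix m (u : 'M[R]_(m, n)) P X :
  orthoproj P -> orthoproj X -> u *m X = u ->
  quad u (P - X) = - sqnorm (u *m (P - X)).
Proof.
move=> oP oX uX.
have := @quad_orthoprojB_ker _ u _ _ (orthoproj_compl oP) (orthoproj_compl oX).
rewrite mulmxBr mulmx1 uX subrr => /(_ erefl).
have -> : 1%:M - P - (1%:M - X) = - (P - X) :> 'M[R]_n.
  by apply/matrixP => i j; rewrite !mxE; ring.
by rewrite quadN mulmxN sqnormN => /eqP; rewrite eqr_oppLR => /eqP.
Qed.

Context (V : 'M[R]_n) (VVt : V *m V^T = 1%:M).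
Context (A : 'M[R]_n) (lam : 'I_n -> R).
Context (VA : forall i, row i V *m A = lam i *: row i V).
Context (bot : pred 'I_n).

Lemma mxtrace_mul_eigen M : \tr (A *m M) = \sum_i lam i * quad (row i V) M.
Proof.
by rewrite (mxtrace_quad_row VVt); apply: eq_bigr => i _; exact: quad_mulmx_l.
Qed.

(** A traceless [M] does not see a shift of the spectrum; with [c] inside the gap, the sign of
    [lam i - c] is decided by [bot i]. *)
Lemma mxtrace_mul_eigen_shift c M : \tr M = 0 ->
  \tr (A *m M) = \sum_i (lam i - c) * quad (row i V) M.
Proof.
move=> M0; under eq_bigr do rewrite mulrBl.
by rewrite big_split /= sumrN -mulr_sumr -(mxtrace_quad_row VVt) M0 mulr0 oppr0
  addr0 mxtrace_mul_eigen.
Qed.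

Context (c delta : R) (delta_gt0 : 0 < delta).
Context (lam_bot : forall i, bot i -> lam i <= c - delta / 2).
Context (lam_top : forall i, ~~ bot i -> c + delta / 2 <= lam i).

(* Equality in the bathtub principle: the gap forces a minimizer of
   [tr (A X)] to be the spectral projection of the lowest eigenvalues. *)
Lemma minimizer_spectral_projection X Y :
  X^T = X -> (forall u : 'rV_n, 0 <= quad u X <= sqnorm u) ->
  (forall i, row i V *m Y = (bot i)%:R *: row i V) -> \tr X = \tr Y ->
  \tr (A *m X) <= \tr (A *m Y) ->
  forall i, row i V *m X = (bot i)%:R *: row i V.
Proof.
move=> Xt X01 VY tXY AXY.
have qY i : quad (row i V) Y = (bot i)%:R.
  rewrite /quad VY -scalemxAl mxtraceZ -/(sqnorm _).
  by rewrite sqnorm_orthogonal_row// mulr1.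
(* [w i] is the deviation of [x i] from the optimal 0-1 occupation. Each unit of it costs at least
   [delta / 2], so optimality makes all of them vanish. *)
pose x i := quad (row i V) X; pose w i := if bot i then 1 - x i else x i.
have w0 i : 0 <= w i.
  have := X01 (row i V); rewrite sqnorm_orthogonal_row// /w -/(x i).
  by case: ifP => _; lra.
have wz : \sum_i w i * (delta / 2) <= 0.
  apply: (@le_trans _ _ (\tr (A *m (X - Y)))); last first.
    by rewrite mulmxBr mxtraceB subr_le0.
  rewrite (mxtrace_mul_eigen_shift c); last by rewrite mxtraceB tXY subrr.
  apply: ler_sum => i _; rewrite quadD quadN qY -/(x i).
  have := w0 i; rewrite /w; have := @lam_bot i; have := @lam_top i.
  by case: (bot i) => /= [_ /(_ isT)|/(_ isT) + _] => h1 h2; nra.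
have hd : 0 <= delta / 2 by move: delta_gt0; lra.
have w_eq0 i : w i = 0.
  apply/eqP; have : \sum_i w i * (delta / 2) == 0.
    rewrite eq_le wz; apply: sumr_ge0 => j _; apply: mulr_ge0 => //; exact: hd.
  rewrite psumr_eq0 => [/allP/(_ i (mem_index_enum _))|j _]; last first.
    by apply: mulr_ge0 => //; exact: hd.
  by rewrite /= mulf_eq0 => /orP[//|/eqP]; move: delta_gt0; lra.
(* Positivity at [u - u *m Z] together with the upper bound at [u *m Z] leaves
   [sqnorm (u *m Z) <= 0]. *)
have ker (Z : 'M[R]_n) (u : 'rV_n) : Z^T = Z ->
    (forall u : 'rV_n, 0 <= quad u Z <= sqnorm u) -> quad u Z = 0 -> u *m Z = 0.
  move=> Zt Z01 uZ; apply: sqnorm_eq0; apply/eqP; rewrite eq_le sqnorm_ge0 andbT.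
  have /andP[+ _] := Z01 (u - u *m Z); have /andP[_] := Z01 (u *m Z).
  rewrite {2}/quad linearB /= !mulmxBl !mulmxBr !mxtraceB.
  rewrite -/(quad u Z) -/(quad (u *m Z) Z) uZ.
  have -> : \tr (u *m Z *m Z *m u^T) = sqnorm (u *m Z).
    by rewrite /sqnorm trmx_mul Zt !mulmxA.
  by rewrite -/(sqnorm (u *m Z)); lra.
move=> i; have := w_eq0 i; rewrite /w; case: (bot i) => xi; last first.
  by rewrite scale0r; apply: ker.
rewrite scale1r; apply/esym/eqP; rewrite -subr_eq0 -{1}[row i V]mulmx1 -mulmxBr.
apply/eqP/ker.
- by rewrite linearB /= trmx1 Xt.
- by move=> u; rewrite quadD quadN quad1; have := X01 u; lra.
- by rewrite quadD quadN quad1 sqnorm_orthogonal_row.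
Qed.

Context (X : 'M[R]_n) (VX : forall i, row i V *m X = (bot i)%:R *: row i V).

Lemma orthoproj_spectral : X^T = X -> orthoproj X.
Proof.
move=> Xt; split=> //.
have VXX : V *m (X *m X) = V *m X.
  apply/row_matrixP => i; rewrite !row_mul mulmxA VX -scalemxAl VX scalerA.
  by case: (bot i); rewrite ?mulr1 ?mulr0.
by rewrite -[RHS]mul1mx -(mulmx1C VVt) -mulmxA -VXX !mulmxA (mulmx1C VVt) mul1mx.
Qed.

Context (oX : orthoproj X) (P : 'M[R]_n) (oP : orthoproj P).
Context (trP : \tr P = \tr X).

Let VX_bot i : bot i -> row i V *m X = row i V.
Proof. by move=> bi; rewrite VX bi scale1r. Qed.

Let VX_top i : ~~ bot i -> row i V *m X = 0.
Proof. by move=> /negbTE bi; rewrite VX bi scale0r. Qed.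

(** On each basis row, [quad] of [P - X] is plus or minus [sqnorm (row i V *m (P - X))], with the
    same sign as [lam i - c]; every term thus gains at least [delta / 2]. *)
Lemma spectral_quadratic_growth :
  delta / 2 * sqnorm (P - X) <= \tr (A *m (P - X)).
Proof.
rewrite (mxtrace_mul_eigen_shift c) ?mxtraceB ?trP ?subrr//.
rewrite (sqnorm_mul_row VVt) mulr_sumr; apply: ler_sum => i _.
have w0 := sqnorm_ge0 (row i V *m (P - X)).
case: (boolP (bot i)) => bi.
  by rewrite quad_orthoprojB_fix ?VX_bot//; have := lam_bot bi; nra.
by rewrite quad_orthoprojB_ker ?VX_top//; have := lam_top bi; nra.
Qed.

Lemma spectral_upper_bound G : (forall i, `|lam i| <= G) ->
  \tr (A *m (P - X)) <= G * sqnorm (P - X).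
Proof.
move=> lamG; rewrite mxtrace_mul_eigen (sqnorm_mul_row VVt) mulr_sumr.
apply: ler_sum => i _; have w0 := sqnorm_ge0 (row i V *m (P - X)).
have := lamG i; rewrite ler_norml => /andP[l1 l2].
case: (boolP (bot i)) => bi.
  by rewrite quad_orthoprojB_fix ?VX_bot//; nra.
by rewrite quad_orthoprojB_ker ?VX_top//; nra.
Qed.

(** Termwise: on bottom rows [lam i - c] is negative and reverses the bound for fixed vectors,
    elsewhere it is positive and keeps the bound for kernel vectors. *)
Lemma mxtrace_diag_part_spectral :
  \tr (A *m diag_part P X) <= - (1 - sqnorm (P - X)) * \tr (A *m (P - X)).
Proof.
rewrite !(mxtrace_mul_eigen_shift c) ?mxtrace_diag_part// ?mxtraceB ?trP ?subrr//.
rewrite mulr_sumr; apply: ler_sum => i _; rewrite mulrCA.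
case: (boolP (bot i)) => bi.
  apply: ler_wnM2l; first by move: (lam_bot bi) delta_gt0; lra.
  exact: quad_diag_part_fix oP oX trP (VX_bot bi).
apply: ler_wpM2l; first by move: (lam_top bi) delta_gt0; lra.
exact: quad_diag_part_ker oP oX trP (VX_top bi).
Qed.

End BottomEigenspace.

(** * Gain and displacement in one step of orthogonal iteration *)

Section OrthogonalIterationStep.
Context {R : realFieldType} {n : nat}.
Implicit Types A P X : 'M[R]_n.

Lemma sqnorm_mul_bound A G2 m (M : 'M[R]_(m, n)) :
  (forall u : 'rV_n, sqnorm (u *m A) <= G2 * sqnorm u) ->
  sqnorm (M *m A) <= G2 * sqnorm M.
Proof.
move=> AG; rewrite sqnorm_row (sqnorm_row M) mulr_sumr.
by apply: ler_sum => i _; rewrite row_mul.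
Qed.

Lemma quad_bound A G m (M : 'M[R]_(m, n)) : 0 <= G ->
  (forall u : 'rV_n, sqnorm (u *m A) <= G ^+ 2 * sqnorm u) ->
  `|quad M A| <= G * sqnorm M.
Proof.
move=> G0 AG; have M0 := sqnorm_ge0 M.
rewrite -(@ler_pXn2r _ 2)// ?nnegrE ?mulr_ge0// real_normK ?num_real//.
apply: le_trans (mxtrace_CauchySchwarz _ _) _.
apply: le_trans (ler_wpM2r M0 (sqnorm_mul_bound M AG)) _.
by rewrite exprMn [X in _ <= _ * X]expr2 mulrA.
Qed.

Section GradientFactor.
Context (g : 'M[R]_n) (eta G : R) (eta_ge0 : 0 <= eta) (G_ge0 : 0 <= G).
Context (gG : forall u : 'rV[R]_n, sqnorm (u *m g) <= G ^+ 2 * sqnorm u).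

(** For [eta * G <= 1 / 5] this makes [1%:M - eta *: g] positive definite, so the first-order gain
    dominates the squared displacement. *)
Lemma quad_gradient_factor m (M : 'M[R]_(m, n)) :
  (1 - eta * G) * sqnorm M <= quad M (1%:M - eta *: g).
Proof.
rewrite quadD quadN quadZ quad1 mulrBl mul1r lerD2l lerN2 -mulrA.
apply: ler_wpM2l => //.
exact: le_trans (ler_norm _) (quad_bound _ G_ge0 gG).
Qed.

Lemma sqnorm_mul_gradient_factor m (M : 'M[R]_(m, n)) :
  sqnorm (M *m (1%:M - eta *: g)) <= (1 + eta * G) ^+ 2 * sqnorm M.
Proof.
rewrite mulmxBr mulmx1 -scalemxAr sqnormD sqnormN sqnormZ linearN mulmxN /=.
rewrite mxtraceN linearZ /= -scalemxAr mxtraceZ mxtrace_trC -/(quad M g).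
have /ler_normlP[+ _] := quad_bound M G_ge0 gG.
have := sqnorm_mul_bound M gG; set q := quad _ _.
move=> /(ler_wpM2l (sqr_ge0 eta)) h1 /(ler_wpM2l eta_ge0) h2; lra.
Qed.

End GradientFactor.

(* Invariance [P' A P = A P] says that [P'] projects onto the range of [A P];
   it turns the first-order gain [tr (A (P' - P))] into a quadratic form. *)
Lemma mxtrace_iteration_gain A P P' : A^T = A ->
  orthoproj P -> orthoproj P' -> P' *m A *m P = A *m P ->
  \tr (A *m (P' - P)) = quad (P' - P) A.
Proof.
move=> At [Pt PP] [Pt' PP'] inv.
have inv' : P *m A *m P' = P *m A.
  by apply: trmx_inj; rewrite !trmx_mul At Pt Pt' mulmxA.
rewrite /quad [(P' - P)^T]linearB /= Pt Pt' mulmxBl !mulmxBr !mulmxBl !mxtraceB.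
rewrite inv inv' !mxtrace_sandwich// (mxtrace_mulC P' A) (mxtrace_mulC P A); ring.
Qed.

(** Invariance inserts [P'] after [1%:M - P], and [sqnorm ((1%:M - P) *m P')] is half of
    [sqnorm (P' - P)]. *)
Lemma iteration_displacement A P P' L : \tr P = \tr P' ->
  orthoproj P -> orthoproj P' -> P' *m A *m P = A *m P ->
  (forall u : 'rV_n, sqnorm (u *m A) <= L * sqnorm u) ->
  sqnorm ((1%:M - P) *m A *m P) <= L / 2 * sqnorm (P' - P).
Proof.
move=> t oP oP' inv AL; have oQ := orthoproj_compl oP.
rewrite -mulmxA -inv !mulmxA; apply: le_trans (sqnorm_mul_orthoproj_le _ oP) _.
apply: le_trans (sqnorm_mul_bound _ AL) _.
have [_ t2] := mxtrace_orthoproj_compl t.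
rewrite (sqnorm_mul_orthoproj2 oQ oP') t2 -sqnormN opprB sqnorm_orthoprojB//.
lra.
Qed.

(** By symmetry of [g] both off-diagonal blocks contribute the same inner product of [B] with [Y].
    Cauchy-Schwarz applies, [sqnorm Y] being at most half of [sqnorm (P - X)]. *)
Lemma mxtrace_off_diag_bound (g : 'M[R]_n) P X : g^T = g ->
  orthoproj P -> orthoproj X -> \tr P = \tr X ->
  \tr (g *m (P *m X *m (1%:M - P) + (1%:M - P) *m X *m P)) ^+ 2
    <= 2 * sqnorm ((1%:M - P) *m g *m P) * sqnorm (P - X).
Proof.
move=> gt oP oX t; have [Pt PP] := oP; have [Xt _] := oX.
have oQ := orthoproj_compl oP; have [Qt QQ] := oQ.
set B := _ *m g *m P; set Q := 1%:M - P in oQ Qt QQ B *.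
pose Y := Q *m X *m P.
have Yt : Y^T = P *m X *m Q by rewrite /Y !trmx_mul Pt Xt Qt mulmxA.
have e1 : \tr (g *m (P *m X *m Q)) = \tr (B *m Y^T).
  have -> : B *m Y^T = Q *m (g *m P *m X) *m Q.
    by rewrite Yt /B !mulmxA -(mulmxA _ P P) PP.
  by rewrite mxtrace_sandwich// (mxtrace_mulC Q) !mulmxA.
have e2 : \tr (g *m (Q *m X *m P)) = \tr (B *m Y^T).
  by rewrite -e1 -Yt -[LHS]mxtrace_tr trmx_mul gt mxtrace_mulC.
rewrite mulmxDr mxtraceD e1 e2.
have := mxtrace_CauchySchwarz B Y.
have /(ler_wpM2l (sqnorm_ge0 B)) : sqnorm Y <= sqnorm (P - X) / 2.
  apply: le_trans (sqnorm_mul_orthoproj_le _ oP) _.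
  have [_ t2] := mxtrace_orthoproj_compl t.
  rewrite sqnorm_mul_orthoproj2// t2 sqnorm_orthoprojB//; lra.
lra.
Qed.

End OrthogonalIterationStep.

(** * Bilinearity of the inner product on symmetric matrices *)

Section SymmetricMatrices.
Context {R : realType} {n : nat}.
Implicit Types A B C : symmx R n.

Lemma symmx_tr A : (A : 'M[R]_n)^T = A.
Proof. exact/eqP/symmx_valP. Qed.

Lemma symdot_sqnorm A : symdot A A = sqnorm A.
Proof. by rewrite /sqnorm symmx_tr. Qed.

Lemma symmx_sqr_norm A : `|A| ^+ 2 = sqnorm A.
Proof.
by rewrite symmx_normE frobenius_symdot sqr_sqrtr ?symdot_ge0// symdot_sqnorm.
Qed.

Lemma symdotDl A B C : symdot (A + B) C = symdot A C + symdot B C.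
Proof. by rewrite /symdot /= mulmxDl mxtraceD. Qed.

Lemma symdotNl A B : symdot (- A) B = - symdot A B.
Proof. by rewrite /symdot /= mulNmx mxtraceN. Qed.

Lemma symdotZl a A B : symdot (a *: A) B = a * symdot A B.
Proof. by rewrite /symdot /= -scalemxAl mxtraceZ. Qed.

Lemma symdotDr A B C : symdot A (B + C) = symdot A B + symdot A C.
Proof. by rewrite !(symdotC A) symdotDl. Qed.

Lemma symdotNr A B : symdot A (- B) = - symdot A B.
Proof. by rewrite !(symdotC A) symdotNl. Qed.

Lemma symdotZr a A B : symdot A (a *: B) = a * symdot A B.
Proof. by rewrite !(symdotC A) symdotZl. Qed.

Lemma symdot_le_norm A B : symdot A B <= `|A| * `|B|.
Proof.
rewrite !symmx_normE !frobenius_symdot -sqrtrM ?symdot_ge0//.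
by apply: le_trans (ler_norm _) _; rewrite -sqrtr_sqr ler_wsqrtr// symdot_CS.
Qed.

End SymmetricMatrices.

(** * First-order inequalities for smooth convex functions *)

Section SmoothConvex.
Context {R : realType} {n : nat}.
Context (f : symmx R n -> R) (gradf : symmx R n -> symmx R n).
Context (f_diff : forall X : symmx R n, differentiable f X).
Context (f_grad : forall X H : symmx R n, 'd f X H = symdot (gradf X) H).
Implicit Types X Y D : symmx R n.

Lemma is_derive_line X D (s : R) :
  is_derive s 1 (fun s : R => f (X + s *: D)) (symdot (gradf (X + s *: D)) D).
Proof.
have E : (fun h : R => h^-1 *:
    (((fun s : R => f (X + s *: D)) \o shift s) (h *: 1) - f (X + s *: D))) =
  (fun h : R => h^-1 *: ((f \o shift (X + s *: D)) (h *: D) - f (X + s *: D))).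
  apply/funext => h /=; congr (_ *: (f _ - _)).
  by rewrite [h *: 1]mulr1 scalerDl addrCA.
have fd : derivable f (X + s *: D) D by exact: diff_derivable.
split; first by rewrite /derivable E; exact: fd.
by rewrite /derive E -f_grad -deriveE.
Qed.

(** One-sided, because convexity and feasibility of a segment only control steps [0 < s <= 1]. *)
Lemma line_quotient_cvg X D :
  s^-1 * (f (X + s *: D) - f X) @[s --> (0 : R)^'+] --> symdot (gradf X) D.
Proof.
have [dl dE] := is_derive_line X D 0; rewrite scale0r addr0 in dE.
apply: cvg_dnbhs_at_right; rewrite -dE.
have -> : (fun s : R => s^-1 * (f (X + s *: D) - f X)) =
    (fun h : R => h^-1 *: (((fun s : R => f (X + s *: D)) \o shift 0) (h *: 1) -
    f (X + 0 *: D))).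
  by apply/funext => h /=; rewrite scale0r !addr0 [h *: 1]mulr1.
exact: dl.
Qed.

Lemma line_derivative_le X D a :
  (forall s, 0 < s <= 1 -> f (X + s *: D) - f X <= s * a) ->
  symdot (gradf X) D <= a.
Proof.
move=> h; apply: (cvgr_to_le (@line_quotient_cvg X D)).
near=> s; have s0 : 0 < s by near: s; exact: nbhs_right_gt.
rewrite ler_pdivrMl//; apply: h; rewrite s0 /=.
by near: s; apply: nbhs_right_le.
Unshelve. all: by end_near. Qed.

Lemma line_derivative_ge X D a :
  (forall s, 0 < s <= 1 -> s * a <= f (X + s *: D) - f X) ->
  a <= symdot (gradf X) D.
Proof.
move=> h; apply: (cvgr_to_ge (@line_quotient_cvg X D)).
near=> s; have s0 : 0 < s by near: s; exact: nbhs_right_gt.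
rewrite ler_pdivlMl//; apply: h; rewrite s0 /=.
by near: s; apply: nbhs_right_le.
Unshelve. all: by end_near. Qed.

Lemma convex_line (f_convex : @convex_function R (symmx R n) setT f) X Y
    (s : R) :
  0 <= s <= 1 -> f (X + s *: (Y - X)) <= f X + s * (f Y - f X).
Proof.
move=> s01.
have := f_convex (Itv01 (proj1 (andP s01)) (proj2 (andP s01))) Y X.
rewrite !inE => /(_ I I); rewrite convRE /conv /= /unstable.onem.
have -> : s *: Y + (1 - s) *: X = X + s *: (Y - X).
  by rewrite scalerBl scale1r scalerBr addrCA.
lra.
Qed.

Lemma convex_first_order (f_convex : @convex_function R (symmx R n) setT f)
    X Y :
  f X + symdot (gradf X) (Y - X) <= f Y.
Proof.
rewrite -lerBrDl; apply: line_derivative_le => s /andP[s0 s1].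
by rewrite lerBlDl; apply: convex_line; rewrite // ltW.
Qed.

Context (beta : R) (beta_gt0 : 0 < beta).
Context (f_smooth : forall X Y, `|gradf X - gradf Y| <= beta * `|X - Y|).

(** The mean value theorem replaces integration: once [s ^+ 2 * K] is subtracted, the Lipschitz
    bound keeps the derivative of [phi] at the intermediate point below the slope at 0. *)
Lemma descent X Y :
  f Y <= f X + symdot (gradf X) (Y - X) + beta / 2 * `|Y - X| ^+ 2.
Proof.
set D := Y - X; set K := beta / 2 * `|D| ^+ 2.
pose phi := fun s : R => f (X + s *: D) - s ^+ 2 * K.
pose dphi := fun s : R => symdot (gradf (X + s *: D)) D - 2 * s * K.
have dphiP (s : R) : is_derive s 1 phi (dphi s).
  apply: is_deriveB; first exact: is_derive_line.
  apply: is_derive_eq. rewrite !scaler0 add0r /GRing.scale /=. ring.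
have cphi : {within `[0, 1], continuous phi}.
  by apply: derivable_within_continuous => s _; have [] := dphiP s.
have [c] := MVT ltr01 (fun s _ => dphiP s) cphi.
rewrite in_itv /= => /andP[c0 _]; rewrite /phi /dphi subr0 mulr1.
rewrite scale0r addr0 scale1r /D (addrC X) subrK -/D.
have : symdot (gradf (X + c *: D) - gradf X) D <= c * (2 * K).
  apply: le_trans (symdot_le_norm _ _) _.
  apply: le_trans (ler_wpM2r (normr_ge0 _) (f_smooth _ _)) _.
  rewrite addrAC subrr add0r normrZ gtr0_norm// /K.
  by rewrite le_eqVlt; apply/orP; left; apply/eqP; field.
rewrite symdotDl symdotNl; lra.
Qed.

(* Apply [descent] to [f - <gradf X, .>], which is minimized at [X], for a
   gradient step of length [1 / beta] from [Y]. *)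
Lemma convex_smooth_lower_bound
    (f_convex : @convex_function R (symmx R n) setT f) X Y :
  f X + symdot (gradf X) (Y - X) + (2 * beta)^-1 * `|gradf Y - gradf X| ^+ 2
    <= f Y.
Proof.
pose E := gradf Y - gradf X; pose Z := Y - beta^-1 *: E.
have h1 := convex_first_order f_convex X Z; have h2 := descent Y Z.
have ZY : Z - Y = - (beta^-1 *: E) by rewrite /Z addrC addKr.
have ZX : Z - X = (Y - X) - beta^-1 *: E by rewrite /Z addrAC.
have EE : symdot (gradf Y) E = symdot (gradf X) E + `|E| ^+ 2.
  by rewrite symmx_sqr_norm -symdot_sqnorm {3}/E symdotDl symdotNl addrC subrK.
rewrite ZX symdotDr symdotNr symdotZr in h1.
rewrite ZY symdotNr symdotZr EE normrN normrZ gtr0_norm ?invr_gt0// in h2.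
rewrite -/E; apply: le_trans
  (_ : f Z + beta^-1 * `|E| ^+ 2 / 2 + beta^-1 * symdot (gradf X) E <= _).
  rewrite invfM; lra.
have -> : f Y = f Y - beta^-1 * (symdot (gradf X) E + `|E| ^+ 2)
  + beta / 2 * (beta^-1 * `|E|) ^+ 2
  + (beta^-1 * `|E| ^+ 2 / 2 + beta^-1 * symdot (gradf X) E).
  by field; rewrite gt_eqF.
lra.
Qed.

End SmoothConvex.

(** * The spectral norm as an operator bound *)

Section SpectralNorm.
Context {R : realType} {n : nat}.

Lemma frobenius_sqnorm m p (A : 'M[R]_(m, p)) :
  frobenius A = Num.sqrt (sqnorm A).
Proof. by rewrite sqnormE. Qed.

Lemma frobenius_mul_le_spectral_norm (A : 'M[R]_n) (x : 'cV[R]_n) :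
  frobenius x <= 1 -> frobenius (A *m x) <= spectral_norm A.
Proof.
move=> x1; apply: ub_le_sup; last by exists x.
(* The Frobenius norm bounds the set, so [sup] is a true supremum and not a default value. *)
exists (frobenius A) => _ [y /= y1 <-]; rewrite !frobenius_sqnorm.
apply: ler_wsqrtr; apply: le_trans (sqnorm_mulmx _ _) _.
apply: ler_piMr; first exact: sqnorm_ge0.
by move: y1; rewrite frobenius_sqnorm -{1}sqrtr1 ler_sqrt.
Qed.

Lemma spectral_norm_ge0 (A : 'M[R]_n) : 0 <= spectral_norm A.
Proof.
apply: le_trans (frobenius_mul_le_spectral_norm (x := 0) A _).
  by rewrite frobenius_sqnorm sqrtr_ge0.
by rewrite frobenius_sqnorm /sqnorm mul0mx mxtrace0 sqrtr0.
Qed.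

(** Symmetry turns the row product into a column product, and the column is scaled to the unit
    sphere. *)
Lemma sqnorm_mul_spectral_norm (A : symmx R n) (u : 'rV[R]_n) :
  sqnorm (u *m A) <= spectral_norm A ^+ 2 * sqnorm u.
Proof.
have [u0|u0] := eqVneq (sqnorm u) 0.
  by rewrite (sqnorm_eq0 u0) mul0mx /sqnorm !mul0mx mxtrace0 mulr0.
have {u0}u0 : 0 < sqnorm u by rewrite lt_def u0 sqnorm_ge0.
pose c := (Num.sqrt (sqnorm u))^-1.
have c2 : c ^+ 2 = (sqnorm u)^-1 by rewrite exprVn sqr_sqrtr// ltW.
have : frobenius (c *: u^T) <= 1.
  by rewrite frobenius_sqnorm sqnormZ c2 sqnorm_tr mulVf ?sqrtr1// gt_eqF.
move=> /(frobenius_mul_le_spectral_norm A).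
rewrite -scalemxAr -(symmx_tr A) -trmx_mul (symmx_tr A).
rewrite frobenius_sqnorm sqnormZ c2 sqnorm_tr => h.
rewrite -ler_pdivrMr// mulrC -[leLHS]sqr_sqrtr; last first.
  by apply: mulr_ge0; [rewrite invr_ge0 ltW|exact: sqnorm_ge0].
by rewrite ler_pXn2r// nnegrE ?sqrtr_ge0 ?spectral_norm_ge0.
Qed.

End SpectralNorm.

(** * Membership in the Fantope *)

Section FantopeGeometry.
Context {R : realType} {n k : nat}.
Implicit Types (X Y : symmx R n) (Q : 'M[R]_(n, k)).

Lemma gram_orthoproj Q : Q^T *m Q = 1%:M -> orthoproj (gram Q : 'M[R]_n).
Proof.
move=> QQ; split; first exact: symmx_tr.
by rewrite /= !mulmxA -(mulmxA Q) QQ mulmx1.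
Qed.

Lemma mxtrace_gram Q : Q^T *m Q = 1%:M -> \tr (gram Q : 'M[R]_n) = k%:R.
Proof. by move=> QQ; rewrite /= mxtrace_mulC QQ mxtrace1. Qed.

Lemma fantope_gram Q : Q^T *m Q = 1%:M -> fantope n k (gram Q).
Proof. by move=> QQ; apply: sub_gen_smallest; exists Q. Qed.

Lemma fantope_segment X Y s : fantope n k X -> fantope n k Y -> 0 <= s <= 1 ->
  fantope n k (X + s *: (Y - X)).
Proof.
move=> FX FY s01 S [cS sS].
have := cS Y X (Itv01 (proj1 (andP s01)) (proj2 (andP s01))).
rewrite !inE => /(_ (FY S (conj cS sS)) (FX S (conj cS sS))).
rewrite /conv /= /unstable.onem.
suff -> : s *: Y + (1 - s) *: X = X + s *: (Y - X) by [].
by rewrite scalerBl scale1r scalerBr addrCA.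
Qed.

(** The conclusion describes a convex set containing every [gram Q], hence containing the hull. *)
Lemma fantope_spec X : fantope n k X ->
  (forall u : 'rV_n, 0 <= quad u (X : 'M[R]_n) <= sqnorm u) /\
  \tr (X : 'M[R]_n) = k%:R.
Proof.
pose S := [set X : symmx R n |
  (forall u : 'rV_n, 0 <= quad u (X : 'M[R]_n) <= sqnorm u) /\
  \tr (X : 'M[R]_n) = k%:R].
apply: (@smallest_sub _ _ _ S); last first.
  move=> _ [Q QQ <-]; split; last exact: mxtrace_gram.
  have oQ := gram_orthoproj QQ => u.
  by rewrite quad_orthoproj// sqnorm_ge0 sqnorm_mul_orthoproj_le.
move=> Y Z s; rewrite !inE => -[Y1 Y2] [Z1 Z2].
have s0 : 0 <= s%:num by []. have s1 : s%:num <= 1 by [].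
split.
  move=> u; have /andP[y0 y1] := Y1 u; have /andP[z0 z1] := Z1 u.
  by rewrite /conv /= /unstable.onem quadD !quadZ; apply/andP; split; nra.
by rewrite /conv /= /unstable.onem mxtraceD !mxtraceZ Y2 Z2; ring.
Qed.

(** Provides the spectral projection on the selected rows, the competitor against which a minimizer
    is compared. *)
Lemma row_orthogonal_gram (O : 'M[R]_n) (h : 'I_k -> 'I_n) :
  O *m O^T = 1%:M -> injective h ->
  let Q := (rowsub h O)^T in
  Q^T *m Q = 1%:M /\
  forall i, row i O *m gram Q = (i \in codom h)%:R *: row i O.
Proof.
move=> OOt hI Q; have OQ : O *m Q = \matrix_(i, j) (i == h j)%:R.
  apply/matrixP => i j; rewrite !mxE.
  have /matrixP/(_ i (h j)) := OOt; rewrite !mxE => <-.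
  by apply: eq_bigr => l _; rewrite !mxE.
have QQ : Q^T *m Q = 1%:M.
  rewrite trmxK mul_rowsub_mx OQ; apply/matrixP => i j.
  by rewrite !mxE (inj_eq hI).
split=> // i; have [/codomP[j ->]|ih] := boolP (i \in codom h).
  have -> : row (h j) O = row j Q^T by rewrite trmxK row_rowsub.
  by rewrite scale1r /= mulmxA -row_mul QQ -row_mul mul1mx.
rewrite scale0r /= mulmxA -row_mul OQ (_ : row i _ = 0) ?mul0mx//.
apply/rowP => j; rewrite !mxE; case: eqP => // ihj.
by rewrite ihj codom_f in ih.
Qed.

End FantopeGeometry.

(** * Ordered eigenvalues with matching eigenvectors *)

Section EigenvalueOrder.
Context {R : realType} {n : nat}.

Lemma size_eigvals (A : symmx R n) : size (eigvals A) = n.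
Proof.
have [_ As] := eigvalsP A; apply: succn_inj.
by rewrite -(size_char_poly A) As size_prod_XsubC.
Qed.

Lemma eigvals_nth_le (A : symmx R n) i j :
  (i <= j)%N -> (j < n)%N -> (eigvals A)`_j <= (eigvals A)`_i.
Proof.
move=> ij jn; have [srt _] := eigvalsP A.
have geT : transitive (>=%R : rel R).
  by move=> x y z /= xy yz; exact: le_trans yz xy.
apply: (sorted_leq_nth geT (fun x => lexx x) 0 srt) => //.
  by rewrite inE size_eigvals (leq_ltn_trans ij).
by rewrite inE size_eigvals.
Qed.

Lemma spectral_eigvals (A : symmx R n) :
  exists2 O : 'M[R]_n, O *m O^T = 1%:M &
    forall i, row i O *m A = (eigvals A)`_i *: row i O.
Proof.
have [_ As] := eigvalsP A.
have [V VVt VA] := real_spectral (symmx_tr A) As.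
exists V => // i; rewrite -row_mul VA mul_diag_mx.
by apply/rowP => j; rewrite !mxE.
Qed.

End EigenvalueOrder.

(** * The eigengap at the optimum, the one-step contraction and the linear rate *)

(** [X] minimizes the linear form of [A] over the Fantope; comparison with the projection onto the
    [k] lowest eigenvectors forces [X] to be that projection, so the spectral estimates apply to
    it. *)
Lemma eigengap_minimizer (R : realType) (n k : nat)
  (hk : (1 <= k)%N) (hkn : (k < n)%N)
  (A X : symmx R n) (delta G : R) (delta_gt0 : 0 < delta) (G_ge0 : 0 <= G)
  (AG : forall u : 'rV[R]_n, sqnorm (u *m A) <= G ^+ 2 * sqnorm u)
  (gap : delta <= eigval (n - k) A - eigval (n - k + 1) A)
  (FX : fantope n k X)
  (X_min : forall Y, fantope n k Y -> 0 <= symdot A (Y - X)) :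
  [/\ orthoproj (X : 'M[R]_n), delta <= 2 * G & forall P : 'M[R]_n,
    orthoproj P -> \tr P = \tr (X : 'M[R]_n) ->
    [/\ delta / 2 * sqnorm (P - X) <= \tr (A *m (P - X)),
        \tr (A *m (P - X)) <= G * sqnorm (P - X) &
        \tr (A *m diag_part P X)
          <= - (1 - sqnorm (P - X)) * \tr (A *m (P - X))]].
Proof.
have [V VVt VA] := spectral_eigvals A.
pose lam (i : 'I_n) := (eigvals A)`_i.
(* Eigenvalues are listed in nonincreasing order from index 0, so the [k] lowest start at index
   [n - k], which holds [eigval (n - k + 1)]. *)
have h_lt (j : 'I_k) : (n - k + j < n)%N by have := ltn_ord j; lia.
pose h (j : 'I_k) := Ordinal (h_lt j).
have hI : injective h by move=> i j /(congr1 val) /= /addnI /val_inj.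
pose bot : pred 'I_n := [pred i | i \in codom h].
have botE i : bot i = (n - k <= i)%N.
  apply/codomP/idP => [[j ->]/=|ni]; first exact: leq_addr.
  have ik : (i - (n - k) < k)%N by have := ltn_ord i; lia.
  by exists (Ordinal ik); apply/val_inj; rewrite /= subnKC.
pose c := (eigval (n - k) A + eigval (n - k + 1) A) / 2.
have lam_bot i : bot i -> lam i <= c - delta / 2.
  rewrite botE => ni; have := eigvals_nth_le A ni (ltn_ord i).
  by move: gap; rewrite /c /lam /eigval addn1 /=; lra.
have lam_top i : ~~ bot i -> c + delta / 2 <= lam i.
  rewrite botE -ltnNge => ni.
  have : (i <= (n - k).-1)%N by lia.
  have : ((n - k).-1 < n)%N by lia.
  move=> n1 /(eigvals_nth_le A)/(_ n1).
  by move: gap; rewrite /c /lam /eigval addn1 /=; lra.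
have [QQ VQ] := row_orthogonal_gram VVt hI.
set Y := gram _ in VQ; have FY : fantope n k Y by exact: fantope_gram.
have [X01 trX] := fantope_spec FX; have trY := mxtrace_gram QQ.
have AXY : \tr (A *m X) <= \tr (A *m Y).
  by have := X_min _ FY; rewrite /symdot /= mulmxBr mxtraceB subr_ge0.
have VX := minimizer_spectral_projection VVt VA delta_gt0 lam_bot lam_top
  (symmx_tr X) X01 VQ (etrans trX (esym trY)) AXY.
have oX := orthoproj_spectral VVt VX (symmx_tr X).
have lamG i : `|lam i| <= G.
  have := quad_bound (row i V) G_ge0 AG.
  rewrite sqnorm_orthogonal_row// mulr1 -[A in quad _ A]mulmx1.
  by rewrite (quad_mulmx_l _ (VA i)) quad1 sqnorm_orthogonal_row// mulr1.
split=> //.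
  have k0 : (0 < k)%N by [].
  have n0 : (0 < n)%N by lia.
  pose i0 := Ordinal n0; pose j0 := h (Ordinal k0).
  have b0 : ~~ bot i0 by rewrite botE /=; lia.
  have b1 : bot j0 by rewrite botE /=; lia.
  have /ler_normlP[_ g1] := lamG i0; have /ler_normlP[g2 _] := lamG j0.
  by have := lam_top _ b0; have := lam_bot _ b1; lra.
move=> P oP trP; split.
- exact: (spectral_quadratic_growth VVt VA lam_bot lam_top VX).
- exact: (spectral_upper_bound VVt VA VX).
- exact: (mxtrace_diag_part_spectral VVt VA delta_gt0 lam_bot lam_top VX).
Qed.

(* [h], [h'] are the optimality gaps before and after the step, [d2] the squared
   distance to the optimum, [e2] the squared change of gradient, [b2] and [m2]
   the squared norms of the off-diagonal gradient and of the displacement. *)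
Lemma contraction_arith (R : realFieldType)
  (beta G M delta eta h h' q d2 e2 b2 m2 gain off cross : R) :
  0 < beta -> 0 <= G -> beta <= M -> G <= M -> 0 < delta -> delta <= 2 * M ->
  eta = 1 / (5 * M) ->
  0 <= h -> 0 <= d2 -> 0 <= e2 -> 0 <= b2 -> 0 <= m2 ->
  M * d2 <= 3 / 100 * delta ->
  delta / 2 * d2 <= q ->
  q + (2 * beta)^-1 * e2 <= h ->
  h' <= h + gain + beta / 2 * m2 ->
  (1 - eta * G) * m2 <= - (eta * gain) ->
  eta ^+ 2 * b2 <= (1 + eta * G) ^+ 2 / 2 * m2 ->
  h <= - (1 - d2) * q + cross - off ->
  cross ^+ 2 <= e2 * d2 ^+ 2 ->
  off ^+ 2 <= 2 * b2 * d2 ->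
  h' <= (1 - delta / (40 * M)) * h.
Proof.
move=> beta0 G0 bM GM delta0 deltaM etaE h0 d0 e0 b0 m0.
move=> dM qd hq h'h gainm bm hle crossle offle.
have M0 : 0 < M by lra.
have eta0 : 0 < eta by rewrite etaE divr_gt0// mulr_gt0.
have etaM : eta * M = 1 / 5 by rewrite etaE; field; rewrite gt_eqF.
have etaG : eta * G <= 1 / 5 by rewrite -etaM ler_pM2l.
have etaG0 : 0 <= eta * G by rewrite mulr_ge0// ltW.
have d1 : d2 <= 6 / 100.
  by rewrite -(ler_pM2l M0); lra.
have q0 : 0 <= q by apply: le_trans qd; apply: mulr_ge0 => //; lra.
have eh : e2 <= 2 * beta * h.
  have : (2 * beta)^-1 * e2 <= h by lra.
  by rewrite ler_pdivrMl// mulr_gt0.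
(* Arithmetic-geometric mean, weighted so that the first term costs only [h / 4] and the second a
   small fraction of [q]. *)
have cross_le : cross <= e2 / (8 * beta) + 2 * beta * d2 ^+ 2.
  have r0 : 0 <= e2 / (8 * beta) + 2 * beta * d2 ^+ 2.
    by rewrite addr_ge0 ?divr_ge0 ?mulr_ge0 ?sqr_ge0// ltW.
  apply: le_trans (ler_norm _) _.
  rewrite -(@ler_pXn2r _ 2)// ?nnegrE// real_normK ?num_real//.
  apply: le_trans crossle _; rewrite -subr_ge0.
  have -> : (e2 / (8 * beta) + 2 * beta * d2 ^+ 2) ^+ 2 - e2 * d2 ^+ 2 =
      (e2 / (8 * beta) - 2 * beta * d2 ^+ 2) ^+ 2.
    by field; rewrite gt_eqF.
  exact: sqr_ge0.
have cross1 : e2 / (8 * beta) <= h / 4.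
  by rewrite ler_pdivrMr ?mulr_gt0//; lra.
have cross2 : 2 * beta * d2 ^+ 2 <= 12 / 100 * q.
  have : beta * d2 * d2 <= 3 / 100 * delta * d2.
    apply: ler_wpM2r => //; apply: le_trans dM; exact: ler_wpM2r.
  lra.
have dq : d2 * q <= 6 / 100 * q by apply: ler_wpM2r.
(* The terms in [q] add up to at most [- (82 / 100) * q], hence drop out. *)
have off_ge : 3 / 4 * h <= - off by lra.
have h2 : 9 / 16 * h ^+ 2 <= 2 * b2 * d2.
  apply: le_trans offle; rewrite -(sqrrN off).
  have -> : 9 / 16 * h ^+ 2 = (3 / 4 * h) ^+ 2 by field.
  by rewrite ler_pXn2r// nnegrE; lra.
(* A gradient-domination inequality: quadratic growth, [delta * d2 <= 2 * h], cancels one factor [h]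
   in [h2]. *)
have bh : 9 / 64 * delta * h <= b2.
  have [->|hn0] := eqVneq h 0; first by rewrite mulr0.
  have hp : 0 < h by rewrite lt_def hn0.
  have dh : delta * d2 <= 2 * h.
    have : 0 <= (2 * beta)^-1 * e2 by rewrite mulr_ge0// invr_ge0; lra.
    lra.
  rewrite -(ler_pM2r hp).
  have : 2 * b2 * (delta * d2) <= 2 * b2 * (2 * h).
    by apply: ler_wpM2l => //; lra.
  have := ler_wpM2l (ltW delta0) h2; lra.
have bm2 : b2 <= 18 * M ^+ 2 * m2.
  have s2 : (1 + eta * G) ^+ 2 <= 36 / 25 by nra.
  have : eta ^+ 2 * b2 <= 18 / 25 * m2.
    by apply: le_trans bm _; apply: ler_wpM2r => //; lra.
  move=> /(ler_wpM2l (sqr_ge0 M)).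
  have -> : M ^+ 2 * (eta ^+ 2 * b2) = (eta * M) ^+ 2 * b2 by ring.
  rewrite etaM; lra.
have gain_le : gain <= - (4 * M * m2).
  have : 4 / 5 * m2 <= - (eta * gain).
    by apply: le_trans gainm; apply: ler_wpM2r => //; lra.
  move=> /(ler_wpM2l (ltW M0)).
  have -> : M * - (eta * gain) = - (eta * M * gain) by ring.
  rewrite etaM; lra.
have bm3 : beta * m2 <= M * m2 by apply: ler_wpM2r.
have -> : (1 - delta / (40 * M)) * h = h - delta * h / (40 * M).
  by field; rewrite gt_eqF.
(* The net decrease is [4 - 1 / 2 = 7 / 2] times [M * m2]. By [bh] and [bm2], [delta * h] is at most
   [128 * M ^+ 2 * m2], within the available [40 * 7 / 2 = 140]. *)
suff : delta * h / (40 * M) <= 7 / 2 * M * m2 by lra.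
have dh0 : 0 <= delta * h by rewrite mulr_ge0// ltW.
rewrite ler_pdivrMr ?mulr_gt0//; lra.
Qed.

Lemma iteration_contraction (R : realType) (n : nat)
  (f : symmx R n -> R) (gradf : symmx R n -> symmx R n) (beta G M delta eta : R)
  (f_convex : @convex_function R (symmx R n) setT f)
  (f_diff : forall X : symmx R n, differentiable f X)
  (f_grad : forall X H : symmx R n, 'd f X H = symdot (gradf X) H)
  (beta_gt0 : 0 < beta)
  (f_smooth : forall X Y, `|gradf X - gradf Y| <= beta * `|X - Y|)
  (G_ge0 : 0 <= G) (betaM : beta <= M) (GM : G <= M)
  (delta_gt0 : 0 < delta) (deltaM : delta <= 2 * M) (etaE : eta = 1 / (5 * M))
  (P P' X : symmx R n) (A := 1%:M - eta *: gradf P : 'M[R]_n)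
  (oP : orthoproj (P : 'M[R]_n)) (oP' : orthoproj (P' : 'M[R]_n))
  (oX : orthoproj (X : 'M[R]_n))
  (trPX : \tr (P : 'M[R]_n) = \tr (X : 'M[R]_n))
  (trPP' : \tr (P : 'M[R]_n) = \tr (P' : 'M[R]_n))
  (inv : P' *m A *m P = A *m P)
  (gradG : forall u : 'rV[R]_n, sqnorm (u *m gradf P) <= G ^+ 2 * sqnorm u)
  (radius : M * `|P - X| ^+ 2 <= 3 / 100 * delta)
  (PX : f X <= f P)
  (growth : delta / 2 * `|P - X| ^+ 2 <= symdot (gradf X) (P - X))
  (diag : \tr (gradf X *m diag_part P X) <=
    - (1 - `|P - X| ^+ 2) * symdot (gradf X) (P - X)) :
  f P' - f X <= (1 - delta / (40 * M)) * (f P - f X).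
Proof.
have M0 : 0 < M by exact: lt_le_trans betaM.
have eta0 : 0 <= eta by rewrite etaE divr_ge0// mulr_ge0// ltW.
have At : A^T = A.
  by rewrite /A linearB /= trmx1 [X in _ - X]linearZ /= symmx_tr.
pose E := (gradf P : 'M[R]_n) - gradf X.
pose B := (1%:M - P) *m gradf P *m P.
pose off := \tr (gradf P *m (P *m X *m (1%:M - P) + (1%:M - P) *m X *m P)).
apply: (@contraction_arith _ beta G M delta eta _ _ (symdot (gradf X) (P - X))
  (`|P - X| ^+ 2) (sqnorm E) (sqnorm B) (`|P' - P| ^+ 2)
  (symdot (gradf P) (P' - P)) off (\tr (E *m diag_part P X))) => //.
- by rewrite subr_ge0.
- exact: sqnorm_ge0.
- exact: sqnorm_ge0.
- have := convex_smooth_lower_bound f_diff f_grad beta_gt0 f_smooth f_convex X P.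
  by rewrite symmx_sqr_norm /E /=; lra.
- by have := descent f_diff f_grad f_smooth P P'; lra.
- have gain := mxtrace_iteration_gain At oP oP' inv.
  have tr0 : \tr (P' - P : 'M[R]_n) = 0 by rewrite mxtraceB trPP' subrr.
  (* Equal traces make the identity part of [A] vanish. *)
  have : \tr (A *m (P' - P)) = - (eta * symdot (gradf P) (P' - P)).
    by rewrite mulmxBl mul1mx mxtraceB tr0 -scalemxAl mxtraceZ sub0r.
  rewrite gain => <-; rewrite symmx_sqr_norm.
  exact: quad_gradient_factor.
(* The identity in [A] has no off-diagonal block, so this block of [A] is [- eta *: B]. *)
- have -> : eta ^+ 2 * sqnorm B = sqnorm ((1%:M - P) *m A *m P).
    rewrite /A mulmxBr mulmxBl mulmx1 (_ : (1%:M - P) *m P = 0); last first.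
      by have [_ PP] := oP; rewrite mulmxBl mul1mx PP subrr.
    by rewrite sub0r sqnormN -scalemxAr -scalemxAl sqnormZ.
  rewrite symmx_sqr_norm; apply: iteration_displacement => // u.
  exact: sqnorm_mul_gradient_factor.
(* On the diagonal part the gradient at [P] is replaced by the one at [X] plus the error [E]. *)
- have := convex_first_order f_diff f_grad f_convex P X.
  have -> : symdot (gradf P) (X - P) = - \tr (gradf P *m ((P : 'M[R]_n) - X)).
    by rewrite /symdot /= -mxtraceN -mulmxN opprB.
  rewrite orthoprojB_split// mulmxBr mxtraceB -/off.
  have -> : \tr (gradf P *m diag_part P X) =
      \tr (gradf X *m diag_part P X) + \tr (E *m diag_part P X).
    by rewrite /E mulmxBl mxtraceB; ring.
  lra.
- rewrite -{1}(tr_diag_part oP oX); apply: le_trans (mxtrace_CauchySchwarz _ _) _.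
  apply: ler_wpM2l; first exact: sqnorm_ge0.
  by rewrite symmx_sqr_norm; exact: sqnorm_diag_part.
- rewrite symmx_sqr_norm; apply: mxtrace_off_diag_bound => //.
  exact: symmx_tr.
Qed.

Theorem theorem3 (R : realType) (n k : nat) (hk : (1 <= k)%N) (hkn : (k < n)%N)
  (f : symmx R n -> R) (gradf : symmx R n -> symmx R n) (beta : R)
  (f_convex : @convex_function R (symmx R n) setT f)
  (f_diff : forall X : symmx R n, differentiable f X)
  (f_grad : forall X H : symmx R n, 'd f X H = symdot (gradf X) H)
  (beta_gt0 : 0 < beta)
  (f_smooth : forall X Y, `|gradf X - gradf Y| <= beta * `|X - Y|)
  (Xs : symmx R n) (Xs_feas : fantope n k Xs)
  (Xs_opt : forall X, fantope n k X -> f Xs <= f X)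
  (delta : R) (delta_gt0 : 0 < delta)
  (gap : delta <= eigval (n - k) (gradf Xs) - eigval (n - k + 1) (gradf Xs))
  (G : R)
  (hG : (ereal_sup [set (spectral_norm (gradf X))%:E | X in fantope n k]
         <= G%:E)%E)
  (eta : R) (eta_def : eta = 1 / (5 * Num.max beta G))
  (Q : nat -> 'M[R]_(n, k)) (U : nat -> 'M[R]_k)
  (Q1 : (Q 1%N)^T *m Q 1%N = 1%:M)
  (Q_step : forall t, (1 <= t)%N ->
     is_qr (Q t - eta *: (gradf (gram (Q t)) *m Q t)) (Q t.+1) (U t.+1))
  (warm : `|gram (Q 1%N) - Xs| <=
     Num.min 1 (Num.sqrt (delta / 2)) * (eta * delta / (2 * (1 + eta * beta))))
  (t : nat) (ht : (1 <= t)%N) :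
  f (gram (Q t)) - f Xs <=
    (f (gram (Q 1%N)) - f Xs) *
    expR (- (delta * (t%:R - 1) / (40 * Num.max beta G))).
Proof.
set M := Num.max beta G in eta_def *.
have betaM : beta <= M by rewrite /M le_max lexx.
have GM : G <= M by rewrite /M le_max lexx orbT.
have M0 : 0 < M by exact: lt_le_trans betaM.
have eta0 : 0 < eta by rewrite eta_def divr_gt0// mulr_gt0.
have specG X : fantope n k X -> spectral_norm (gradf X) <= G.
  move=> FX; rewrite -lee_fin; apply: le_trans hG.
  by apply: ereal_sup_ubound; exists X.
have G0 : 0 <= G by apply: le_trans (specG _ Xs_feas); exact: spectral_norm_ge0.
have gG X (u : 'rV[R]_n) : fantope n k X ->
    sqnorm (u *m gradf X) <= G ^+ 2 * sqnorm u.
  move=> FX; apply: le_trans (sqnorm_mul_spectral_norm _ _) _.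
  apply: ler_wpM2r; first exact: sqnorm_ge0.
  by rewrite ler_pXn2r ?nnegrE ?spectral_norm_ge0 ?specG.
have Xs_min Y : fantope n k Y -> 0 <= symdot (gradf Xs) (Y - Xs).
  move=> FY; apply: (line_derivative_ge f_diff f_grad) => s /andP[s0 s1].
  rewrite mulr0 subr_ge0; apply: Xs_opt; apply: fantope_segment => //.
  by rewrite s1 ltW.
have [oX deltaG geom] := eigengap_minimizer hk hkn delta_gt0 G0
  (fun u => gG Xs u Xs_feas) gap Xs_feas Xs_min.
have deltaM : delta <= 2 * M by lra.
have [_ trX] := fantope_spec Xs_feas.
have QQ s : (1 <= s)%N -> (Q s)^T *m Q s = 1%:M.
  by case: s => // -[//|s] _; have [] := Q_step s.+1 isT.
pose h s := f (gram (Q s)) - f Xs.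
pose d2 s := sqnorm (gram (Q s) - Xs : 'M[R]_n).
have FQ s : (1 <= s)%N -> fantope n k (gram (Q s)).
  by move=> /QQ; exact: fantope_gram.
have oQ s : (1 <= s)%N -> orthoproj (gram (Q s) : 'M[R]_n).
  by move=> /QQ; exact: gram_orthoproj.
have trQ s : (1 <= s)%N -> \tr (gram (Q s) : 'M[R]_n) = \tr (Xs : 'M[R]_n).
  by move=> /QQ /mxtrace_gram ->.
have h0 s : (1 <= s)%N -> 0 <= h s by move=> /FQ /Xs_opt; rewrite subr_ge0.
have h_lower s : (1 <= s)%N ->
    symdot (gradf Xs) (gram (Q s) - Xs) +
    (2 * beta)^-1 * sqnorm (gradf (gram (Q s)) - gradf Xs : 'M[R]_n) <= h s.
  move=> s1; rewrite /h.
  have := convex_smooth_lower_bound f_diff f_grad beta_gt0 f_smooth f_convex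
    Xs (gram (Q s)).
  rewrite symmx_sqr_norm /=; lra.
have growth s : (1 <= s)%N -> delta / 2 * d2 s <= h s.
  move=> s1; have [g1 _ _] := geom _ (oQ s s1) (trQ s s1).
  apply: le_trans g1 _; apply: le_trans (h_lower s s1).
  rewrite lerDl mulr_ge0 ?sqnorm_ge0// invr_ge0; lra.
(* Descent from [Xs]: the linear term costs [G] and the quadratic one [beta / 2], both in units of
   [d2]. *)
have h1_le : h 1%N <= 3 / 2 * M * d2 1%N.
  have [_ g2 _] := geom _ (oQ 1%N isT) (trQ 1%N isT).
  have := descent f_diff f_grad f_smooth Xs (gram (Q 1%N)).
  rewrite symmx_sqr_norm -/(d2 1%N) /symdot /= => h1.
  have d0 : 0 <= d2 1%N := sqnorm_ge0 _.
  have := ler_wpM2r d0 GM; have := ler_wpM2r d0 betaM.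
  move: g2; rewrite -/(d2 1%N) /h /=; lra.
(* The minimum is bounded by 1 and [1 + eta * beta] from below by 1, which leaves the radius
   [eta * delta / 2]. *)
have d1_le : d2 1%N <= (delta / (10 * M)) ^+ 2.
  rewrite /d2 -symmx_sqr_norm ler_pXn2r ?nnegrE//; last first.
    by rewrite divr_ge0// ?mulr_ge0// ltW.
  apply: le_trans warm _.
  have r0 : 0 <= eta * delta / (2 * (1 + eta * beta)).
    by rewrite divr_ge0 ?mulr_ge0 ?addr_ge0 ?mulr_ge0// ltW.
  apply: (@le_trans _ _ (1 * (eta * delta / (2 * (1 + eta * beta))))).
    by apply: ler_wpM2r => //; rewrite ge_min lexx.
  have -> : delta / (10 * M) = eta * delta / 2.
    by rewrite eta_def; field; rewrite gt_eqF.
  rewrite mul1r ler_wpM2l ?mulr_ge0 ?(ltW eta0) ?(ltW delta_gt0)//.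
  rewrite lef_pV2 ?posrE ?mulr_gt0 ?addr_gt0 ?mulr_gt0//.
  have : 0 <= eta * beta by rewrite mulr_ge0// ltW.
  lra.
have h1_radius : M * h 1%N <= 3 / 200 * delta ^+ 2.
  have := ler_wpM2l (ltW M0) h1_le.
  have := ler_wpM2l (ltW (exprn_gt0 2 M0)) d1_le.
  rewrite (_ : M ^+ 2 * (delta / (10 * M)) ^+ 2 = delta ^+ 2 / 100); last first.
    by field; rewrite gt_eqF.
  lra.
(* Growth bounds [delta * d2 s] by [2 * h 1]; [h1_radius] then carries the spare factor [delta]. *)
have radius s : (1 <= s)%N -> h s <= h 1%N -> M * d2 s <= 3 / 100 * delta.
  move=> s1 hs; rewrite -(ler_pM2l delta_gt0).
  have := ler_wpM2l (ltW M0) (growth s s1); have := ler_wpM2l (ltW M0) hs.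
  move: h1_radius; lra.
have step s : (1 <= s)%N -> h s <= h 1%N ->
    h s.+1 <= (1 - delta / (40 * M)) * h s.
  move=> s1 hs; have [Zs _ _] := Q_step s s1.
  have [g1 _ g3] := geom _ (oQ s s1) (trQ s s1).
  rewrite /h; apply: (iteration_contraction f_convex f_diff f_grad beta_gt0 f_smooth G0
    betaM GM delta_gt0 deltaM eta_def) => //.
  - exact: oQ.
  - exact: oQ.
  - exact: trQ.
  - by rewrite !trQ.
  (* The factorization places the range of [A *m Q s] inside that of [Q s.+1], which the new
     projection fixes. *)
  - have AQ : (1%:M - eta *: gradf (gram (Q s))) *m Q s = Q s.+1 *m U s.+1.
      by rewrite -Zs mulmxBl mul1mx -scalemxAl.
    rewrite /= !mulmxA -(mulmxA _ _ (Q s)) AQ.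
    by rewrite !mulmxA -(mulmxA (Q s.+1) _ (Q s.+1)) QQ// mulmx1.
  - by move=> u; apply: gG; exact: FQ.
  - by rewrite symmx_sqr_norm; exact: radius.
  - by apply: Xs_opt; exact: FQ.
  - by rewrite symmx_sqr_norm.
  - by rewrite symmx_sqr_norm.
pose r := delta / (40 * M).
have r0 : 0 <= r by rewrite divr_ge0 ?mulr_ge0// ltW.
suff : h t <= h 1%N * expR (- (r * (t%:R - 1))) by rewrite /r mulrAC.
(* Index 0 is excluded by [ht]; the base case is [t = 1]. *)
elim: t ht => // -[_ _|s IHs _].
  by rewrite subrr mulr0 oppr0 expR0 mulr1.
have {}IHs := IHs isT.
(* The exponential bound itself keeps the gap below its initial value, which is what [step]
   requires. *)
have hs : h s.+1 <= h 1%N.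
  apply: le_trans IHs _; apply: ler_piMr; first exact: h0.
  by rewrite -expR0 ler_expR oppr_le0 mulr_ge0// subr_ge0 ler1n.
apply: le_trans (step s.+1 isT hs) _.
apply: (@le_trans _ _ (expR (- r) * h s.+1)).
  by apply: ler_wpM2r; [exact: h0|exact: expR_ge1Dx].
apply: le_trans (ler_wpM2l (expR_ge0 _) IHs) _.
rewrite mulrCA -expRD le_eqVlt; apply/orP; left; apply/eqP.
by congr (_ * expR _); rewrite [s.+2%:R]mulrS; ring.
Qed.
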